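(* If $R$ is a left Noetherian ring such that ${}_RR$ satisfies the Auslander condition, then $\mathcal{AC}^{<\infty}$ is a resolving subcategory of the category $R$-Mod of left $R$-modules.
   Context: Rings are associative with identity. For a left $R$-module $M$, let $0\to M\to E^0(M)\to E^1(M)\to\cdots$ be a minimal injective coresolution. The module $M$ satisfies the Auslander condition if the flat dimension of $E^i(M)$ is at most $i$ for every $i\geqslant 0$; $\mathcal{AC}$ is the class of left $R$-modules satisfying the Auslander condition, and ${}_RR$ denotes $R$ as a left $R$-module. $\mathcal{AC}^{<\infty}$ is the class of left $R$-modules $M$ for which there are an integer $m\geqslant 0$ and an exact sequence $0\to P_m\to\cdots\to P_0\to M\to 0$ of left $R$-modules with each $P_i\in\mathcal{AC}$. A full subcategory $\mathcal{C}$ of $R$-Mod is resolving if it contains all projective modules and is closed under direct summands, extensions and kernels of surjective homomorphisms. *)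

(* Defs.v *)
From HB Require Import structures.
From mathcomp Require Import all_boot all_algebra.
From mathcomp.classical Require Import boolp.
From mathcomp.multinomials Require Import freeg.

Set Implicit Arguments.
Unset Strict Implicit.
Unset Printing Implicit Defensive.

Import GRing.Theory.
Local Open Scope ring_scope.
Local Open Scope quotient_scope.

(* Left R-modules are lmodType R and right R-modules are lmodType R^c: for
   x : A with A : lmodType R^c, the product x r is written (r : R^c) *: x.

   Submodules are boolean predicates closed under GRing.submod_closed.  With
   the excluded middle of mathcomp.classical.boolp every subset is of this
   form, so this is not a restriction to decidable submodules. *)

Definition surjective (T U : Type) (f : T -> U) : Prop :=
  forall y, exists x, f x = y.

Definition exact_at (R : pzRingType) (A B C : lmodType R)
    (f : {linear A -> B}) (g : {linear B -> C}) : Prop :=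
  forall y, g y = 0 <-> exists x, f x = y.

Definition short_exact (R : pzRingType) (A B C : lmodType R)
    (f : {linear A -> B}) (g : {linear B -> C}) : Prop :=
  [/\ injective f, exact_at f g & surjective g].

Definition zero_module (R : pzRingType) (M : lmodType R) : Prop :=
  forall x : M, x = 0.

Definition left_noetherian (R : pzRingType) : Prop :=
  forall I : nat -> {pred R^o},
    (forall n, GRing.submod_closed (I n)) ->
    (forall n, {subset I n <= I n.+1}) ->
    exists N, forall n, (N <= n)%N -> I n =i I N.

Definition projective_module (R : pzRingType) (P : lmodType R) : Prop :=
  forall (A B : lmodType R) (p : {linear A -> B}) (g : {linear P -> B}),
    surjective p -> exists h : {linear P -> A}, forall x, p (h x) = g x.

Definition injective_module (R : pzRingType) (E : lmodType R) : Prop :=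
  forall (A B : lmodType R) (i : {linear A -> B}) (g : {linear A -> E}),
    injective i -> exists h : {linear B -> E}, forall x, h (i x) = g x.

Section Tensor.
Variable R : pzRingType.

Section Construction.
Variables (A : lmodType R^c) (M : lmodType R).

(* The subgroup of the free abelian group on A * M whose quotient is the
   tensor product of A and M over R. *)
Inductive tensor_rel : {freeg (A * M)%type / int} -> Prop :=
| tensor_rel0 : tensor_rel 0
| tensor_relB u v : tensor_rel u -> tensor_rel v -> tensor_rel (u - v)
| tensor_relDl a b m :
    tensor_rel (<< (a + b, m) >> - << (a, m) >> - << (b, m) >>)
| tensor_relDr a m n :
    tensor_rel (<< (a, m + n) >> - << (a, m) >> - << (a, n) >>)
| tensor_relZ (r : R) a m :
    tensor_rel (<< ((r : R^c) *: a, m) >> - << (a, r *: m) >>).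

Definition tensor_pred : {pred {freeg (A * M)%type / int}} :=
  fun u => `[< tensor_rel u >].

Fact tensor_pred_closed : zmod_closed tensor_pred.
Proof.
split=> [|u v /asboolP hu /asboolP hv]; apply/asboolP;
  [exact: tensor_rel0 | exact: tensor_relB].
Qed.

HB.instance Definition _ := GRing.isZmodClosed.Build _ tensor_pred
  tensor_pred_closed.

Definition tensor : zmodType := Quotient.quot tensor_pred.

Definition tens (a : A) (m : M) : tensor := \pi_tensor << (a, m) >>.

Definition balanced (G : zmodType) (b : A -> M -> G) : Prop :=
  [/\ forall a a' m, b (a + a') m = b a m + b a' m,
      forall a m m', b a (m + m') = b a m + b a m'
    & forall (r : R) a m, b ((r : R^c) *: a) m = b a (r *: m)].

Definition tensor_lift (G : zmodType) (b : A -> M -> G) (x : tensor) : G :=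
  fglift (fun p => b p.1 p.2 : zmodule G) (repr x).

Lemma tensor_eqP u v : reflect (tensor_rel (u - v)) (\pi_tensor u == \pi_tensor v).
Proof. by rewrite -Quotient.idealrBE; apply: asboolP. Qed.

Let pi_tensorB u v : \pi_tensor u - \pi_tensor v = \pi_tensor (u - v).
Proof. by rewrite !piE. Qed.

Lemma tens_balanced : balanced tens.
Proof.
split=> [a a' m|a m m'|r a m]; rewrite /tens.
- apply/eqP; rewrite -subr_eq pi_tensorB; apply/tensor_eqP.
  by rewrite addrAC; exact: tensor_relDl.
- apply/eqP; rewrite -subr_eq pi_tensorB; apply/tensor_eqP.
  by rewrite addrAC; exact: tensor_relDr.
- by apply/eqP/tensor_eqP; exact: tensor_relZ.
Qed.

Section Lift.
Variables (G : zmodType) (b : A -> M -> G).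
Hypothesis bal_b : balanced b.

Let lift0 (u : {freeg (A * M)%type / int}) : G :=
  fglift (fun p => b p.1 p.2 : zmodule G) u.

Let lift0B u v : lift0 (u - v) = lift0 u - lift0 v.
Proof. exact: (@lift_is_additive int _ (zmodule G) _ u v). Qed.

Let lift0U a m : lift0 << (a, m) >> = b a m.
Proof. by rewrite /lift0 liftU scale1r. Qed.

Let lift0_rel u : tensor_rel u -> lift0 u = 0.
Proof.
case: bal_b => bDl bDr bZ.
elim=> [|x y _ hx _ hy|a a' m|a m m'|r a m]; rewrite ?lift0B ?lift0U.
- by have := lift0B 0 0; rewrite !subrr.
- by rewrite hx hy subrr.
- by rewrite bDl -addrA -opprD subrr.
- by rewrite bDr -addrA -opprD subrr.
- by rewrite bZ subrr.
Qed.

Let lift_pi u : tensor_lift b (\pi u) = lift0 u.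
Proof.
apply/eqP; rewrite -subr_eq0 [tensor_lift b _]/(lift0 _) -lift0B; apply/eqP/lift0_rel.
by apply/tensor_eqP; rewrite reprK.
Qed.

Lemma tensor_lift_is_zmod_morphism : zmod_morphism (tensor_lift b).
Proof.
move=> x y; rewrite -[x]reprK -[y]reprK.
by rewrite pi_tensorB !lift_pi lift0B.
Qed.

Lemma tensor_liftE a m : tensor_lift b (tens a m) = b a m.
Proof. by rewrite lift_pi lift0U. Qed.

End Lift.

End Construction.

Section Functoriality.
Variables (A B : lmodType R^c) (f : {linear A -> B}) (M : lmodType R).

Definition tensor_map : tensor A M -> tensor B M :=
  tensor_lift (fun a m => tens (f a) m).

Fact tensor_map_balanced : balanced (fun a m => tens (f a) m : tensor B M).
Proof.
have [bDl bDr bZ] := tens_balanced B M.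
by split=> *; rewrite ?linearD ?linearZ ?bDl ?bDr ?bZ.
Qed.

HB.instance Definition _ := GRing.isZmodMorphism.Build _ _ tensor_map
  (tensor_lift_is_zmod_morphism tensor_map_balanced).

Lemma tensor_mapE a m : tensor_map (tens a m) = tens (f a) m.
Proof. exact: (tensor_liftE tensor_map_balanced). Qed.

End Functoriality.

End Tensor.

Arguments tensor_map {R A B} f M x.

(* The functor - (x) M is right exact for every M, so that it is exact if and
   only if it preserves injective maps. *)
Definition flat_module (R : pzRingType) (M : lmodType R) : Prop :=
  forall (A B : lmodType R^c) (f : {linear A -> B}),
    injective f -> injective (tensor_map f M).

(* There is an exact sequence 0 -> P m -> ... -> P 0 -> M -> 0 with every P i
   in C; it is extended by zero modules in degrees i > m. *)
Definition has_resolution (R : pzRingType) (C : lmodType R -> Prop) (m : nat)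
    (M : lmodType R) : Prop :=
  exists (P : nat -> lmodType R) (d : forall i, {linear P i.+1 -> P i})
         (e : {linear P 0%N -> M}),
    [/\ forall i, (i <= m)%N -> C (P i),
        forall i, (m < i)%N -> zero_module (P i),
        surjective e, exact_at (d 0%N) e
      & forall i, exact_at (d i.+1) (d i)].

Definition flat_dim_le (R : pzRingType) (n : nat) (M : lmodType R) : Prop :=
  has_resolution (@flat_module R) n M.

Definition essential_image (R : pzRingType) (A E : lmodType R)
    (f : {linear A -> E}) : Prop :=
  forall S : {pred E}, GRing.submod_closed S ->
    (forall x, f x \in S -> f x = 0) -> forall y, y \in S -> y = 0.

Definition minimal_injective_coresolution (R : pzRingType) (M : lmodType R)
    (E : nat -> lmodType R) (eta : {linear M -> E 0%N})
    (d : forall i, {linear E i -> E i.+1}) : Prop :=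
  [/\ forall i, injective_module (E i),
      injective eta /\ exact_at eta (d 0%N),
      forall i, exact_at (d i) (d i.+1),
      essential_image eta
    & forall i, essential_image (d i)].

(* Minimal injective coresolutions exist and are unique up to isomorphism, so
   the choice of one of them is immaterial. *)
Definition auslander_condition (R : pzRingType) (M : lmodType R) : Prop :=
  exists (E : nat -> lmodType R) (eta : {linear M -> E 0%N})
         (d : forall i, {linear E i -> E i.+1}),
    minimal_injective_coresolution eta d /\ forall i, flat_dim_le i (E i).

Definition AC_fin (R : pzRingType) (M : lmodType R) : Prop :=
  exists m : nat, has_resolution (@auslander_condition R) m M.

Definition resolving (R : pzRingType) (C : lmodType R -> Prop) : Prop :=
  [/\ forall P, projective_module P -> C P,
      forall (M N N' : lmodType R) (phi : {linear M -> (N * N')%type}),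
        bijective phi -> C M -> C N,
      forall (A B D : lmodType R) (f : {linear A -> B}) (g : {linear B -> D}),
        short_exact f g -> C A -> C D -> C B
    & forall (A B D : lmodType R) (f : {linear A -> B}) (g : {linear B -> D}),
        short_exact f g -> C B -> C D -> C A].

(* Main.v *)
Require Import Defs.
From HB Require Import structures.
From mathcomp Require Import all_boot all_algebra.
From mathcomp.classical Require Import boolp classical_sets functions.
From mathcomp.multinomials Require Import freeg.
Require Import Defs.

(**
Under the hypotheses the class AC of modules satisfying the Auslander condition
is itself resolving ([auslander_resolving]), and for every resolving class C the
modules with a finite resolution by members of C again form a resolving class
([finite_resdim_resolving]). The second statement is the usual comparison of syzygies: by pullback and the horseshoe
lemma, if M has C-dimension at most n+1, then the kernel of any surjection from
a member of C onto M has C-dimension at most n, so that every closure property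
passes from C to the syzygies and back.

For AC it is convenient to drop minimality. [ac_from n M] says that M has some
injective coresolution whose i-th term has flat dimension at most n + i; it is
the largest predicate such that M embeds in an injective module of flat
dimension at most n with a cokernel satisfying [ac_from n.+1]. Closure under
extensions is the horseshoe lemma. If A is the kernel of a surjection from B
to C and B embeds in E, then E / A is an extension of E / B by C, which gives
closure under kernels of surjections.

Direct summands and the return to minimal coresolutions are treated together
([ac_summand_step]). If N (+) N' embeds in an injective module I, Zorn's lemma
gives I = E (+) T with E an essential extension of N and T containing N'. Then
E is injective, its flat dimension is at most that of I, and E / N is a summand
of the cokernel of N (+) N' in I. No injective envelope has to be constructed
apart from a given injective module.

Finally a projective module P is a summand of a direct sum of copies of R. Over
a left Noetherian ring direct sums of injective modules are injective by Baer's
criterion, and direct sums of flat modules are flat, so that a direct sum of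
copies of the given coresolution of R is a coresolution of the free module with
the same bounds.

The bounds on flat dimension are inherited by finite products and direct
summands because [finite_resdim_resolving] rests on statements valid for any
resolving class, and flat modules form one ([flat_resolving]). The point of the
latter is that, if L / K is flat, then B (x) K -> B (x) L is injective for every
right module B, which is proved by covering B with a free module.
*)

Set Implicit Arguments.
Unset Strict Implicit.
Unset Printing Implicit Defensive.

Import GRing.Theory.
Local Open Scope ring_scope.

(** * Linear maps, submodules and quotients *)

(** A subset of a module that is a submodule; [submodule_exists] and
[quotient_exists] realise it as the image of an injection and as the kernel of
a surjection. *)
Definition is_submod (R : pzRingType) (M : lmodType R) (S : M -> Prop) : Prop :=
  S 0 /\ forall a x y, S x -> S y -> S (a *: x + y).

Section LinearMaps.
Variable R : pzRingType.

Lemma linear_of_fun (A B : lmodType R) (f : A -> B) :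
  (forall a x y, f (a *: x + y) = a *: f x + f y) ->
  exists g : {linear A -> B}, forall x, g x = f x.
Proof.
move=> hf.
pose g : {linear A -> B} := HB.pack f (GRing.isLinear.Build R A B *:%R f hf).
by exists g.
Qed.

(** A total linear relation that relates 0 only to 0 is the graph of a linear
map. Most linear maps below are obtained in this way. *)
Lemma linear_of_rel (A B : lmodType R) (T : A -> B -> Prop) :
  (forall x, exists y, T x y) -> (forall y, T 0 y -> y = 0) ->
  (forall a x x' y y', T x y -> T x' y' -> T (a *: x + x') (a *: y + y')) ->
  exists f : {linear A -> B}, forall x, T x (f x).
Proof.
move=> Ttot T0 Tlin; have [f Tf] := choice Ttot.
have Tfun x y y' : T x y -> T x y' -> y = y'.
  move=> Txy Txy'; apply/eqP; rewrite -subr_eq0; apply/eqP/T0.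
  have := Tlin (-1) _ _ _ _ Txy' Txy.
  by rewrite !scaleN1r [- x + _]addrC subrr [- y' + _]addrC.
have [|g gE] := @linear_of_fun A B f.
  by move=> a x y; apply: Tfun (Tf _) _; apply: Tlin.
by exists g => x; rewrite gE.
Qed.

End LinearMaps.

Section SubmoduleType.
Variables (R : pzRingType) (M : lmodType R) (S : M -> Prop).
Hypothesis subS : is_submod S.

Let P : {pred M} := fun x => `[< S x >].

Let P_closed : GRing.submod_closed P.
Proof.
case: subS => S0 SD; split=> [|a x y /asboolP Sx /asboolP Sy]; apply/asboolP => //.
exact: SD.
Qed.

HB.instance Definition _ := GRing.isSubmodClosed.Build R M P P_closed.

Let K := {x : M | P x}.

HB.instance Definition _ := SubType.on K.
HB.instance Definition _ := Choice.on K.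
HB.instance Definition _ := [SubChoice_isSubLmodule of K by <:].

Lemma submodule_exists : exists (K : lmodType R) (i : {linear K -> M}),
  injective i /\ forall x, S x <-> exists k, i k = x.
Proof.
exists K, (val : {linear K -> M}); split; first exact: val_inj.
move=> x; split=> [Sx|[k <-]]; last by apply/asboolP; exact: valP k.
have Px : P x by apply/asboolP.
by exists (exist _ x Px).
Qed.

End SubmoduleType.

Section QuotientType.
Variables (R : pzRingType) (M : lmodType R) (S : M -> Prop).
Hypothesis subS : is_submod S.
Local Open Scope quotient_scope.

Let P : {pred M} := fun x => `[< S x >].

Let P_closed : zmod_closed P.
Proof.
case: subS => S0 SD; split=> [|x y /asboolP Sx /asboolP Sy]; apply/asboolP => //.
by have := SD (-1) _ _ Sy Sx; rewrite scaleN1r addrC.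
Qed.

HB.instance Definition _ := GRing.isZmodClosed.Build _ P P_closed.

Let Q := Quotient.quot P.

HB.instance Definition _ := GRing.Zmodule.on Q.

Let p (x : M) : Q := \pi_Q x.

Let pB x y : p (x - y) = p x - p y.
Proof. by rewrite /p !piE. Qed.

Let pD x y : p (x + y) = p x + p y.
Proof. by rewrite /p !piE. Qed.

Let p_eq x y : p x = p y <-> S (x - y).
Proof.
split=> [/eqP|Sxy]; first by rewrite /p -Quotient.idealrBE => /asboolP.
by apply/eqP; rewrite /p -Quotient.idealrBE; apply/asboolP.
Qed.

Let SZ a x : S x -> S (a *: x).
Proof. by case: subS => S0 SD Sx; rewrite -[_ *: _]addr0; exact: SD. Qed.

Let sc (a : R) (q : Q) : Q := p (a *: repr q).

Let scE a x : sc a (p x) = p (a *: x).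
Proof. by apply/p_eq; rewrite -scalerBr; apply/SZ/p_eq; rewrite /p reprK. Qed.

Let pK q : p (repr q) = q. Proof. exact: reprK. Qed.

Let scA a b q : sc a (sc b q) = sc (a * b) q.
Proof. by rewrite -[q]pK !scE scalerA. Qed.
Let sc1 : left_id 1 sc.
Proof. by move=> q; rewrite -[q]pK !scE scale1r. Qed.
Let scDr : right_distributive sc +%R.
Proof. by move=> a q r; rewrite -[q]pK -[r]pK -pD !scE -pD scalerDr. Qed.
Let scDl q : {morph sc^~ q : a b / a + b}.
Proof. by move=> a b; rewrite -[q]pK !scE -pD scalerDl. Qed.

HB.instance Definition _ := GRing.Zmodule_isLmodule.Build R Q scA sc1 scDr scDl.

Lemma quotient_exists : exists (Q : lmodType R) (p : {linear M -> Q}),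
  surjective p /\ forall x, p x = 0 <-> S x.
Proof.
have [|g gE] := @linear_of_fun R M Q p.
  by move=> a x y; rewrite pD -scE.
exists Q, g; split=> [q|x]; first by exists (repr q); rewrite gE pK.
have p0 : p 0 = 0 by rewrite -(subrr 0) pB subrr.
by rewrite gE -p0 p_eq subr0.
Qed.

End QuotientType.

(** * Kernels, cokernels and factorisations *)

Section Toolbox.
Variable R : pzRingType.

Lemma cokernel_exists (A B : lmodType R) (f : {linear A -> B}) :
  exists (C : lmodType R) (p : {linear B -> C}), surjective p /\ exact_at f p.
Proof.
have [|C [p [ps pE]]] := @quotient_exists R B (fun y => exists x, f x = y).
  split=> [|a _ _ [x <-] [y <-]]; first by exists 0; rewrite linear0.
  by exists (a *: x + y); rewrite linearP.
by exists C, p; split=> // y; exact: pE.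
Qed.

Lemma kernel_exists (B C : lmodType R) (g : {linear B -> C}) :
  exists (K : lmodType R) (i : {linear K -> B}), injective i /\ exact_at i g.
Proof.
have [|K [i [ii iE]]] := @submodule_exists R B (fun y => g y = 0).
  split=> [|a x y gx gy]; first by rewrite linear0.
  by rewrite linearP gx gy scaler0 addr0.
by exists K, i; split=> // y; exact: iE.
Qed.

Lemma factor_surj (A B C : lmodType R) (p : {linear A -> B}) (h : {linear A -> C}) :
  surjective p -> (forall x, p x = 0 -> h x = 0) ->
  exists k : {linear B -> C}, forall x, k (p x) = h x.
Proof.
move=> ps ph.
have [|y [x [px <-]]|a x x' y y' [u [<- <-]] [v [<- <-]]|k kE] :=
    @linear_of_rel R B C (fun y z => exists x, p x = y /\ h x = z).
- by move=> y; have [x <-] := ps y; exists (h x), x.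
- exact: ph.
- by exists (a *: u + v); rewrite !linearP.
exists k => x; have [x' [pE <-]] := kE (p x).
apply/eqP; rewrite -subr_eq0 -linearB; apply/eqP/ph.
by rewrite linearB pE subrr.
Qed.

Lemma factor_inj (A B C : lmodType R) (i : {linear A -> B}) (h : {linear C -> B}) :
  injective i -> (forall x, exists y, i y = h x) ->
  exists k : {linear C -> A}, forall x, i (k x) = h x.
Proof.
move=> ii ih; apply: (@linear_of_rel R C A (fun x y => i y = h x)) => //.
- by move=> y; rewrite linear0 => /eqP; rewrite -[0](linear0 i) => /eqP/ii.
- by move=> a x x' y y' iy iy'; rewrite !linearP iy iy'.
Qed.

Lemma linear_inverse (A B : lmodType R) (f : {linear A -> B}) :
  injective f -> surjective f ->
  exists g : {linear B -> A}, cancel f g /\ cancel g f.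
Proof.
move=> fi fs; have [|g gE] := @factor_inj A B B f idfun fi; first exact: fs.
by exists g; split=> x; [apply: fi|]; rewrite gE.
Qed.

Lemma zero_module_exists : exists Z : lmodType R, zero_module Z.
Proof.
have [Z [p [ps pE]]] := cokernel_exists (idfun : {linear R^o -> R^o}).
by exists Z => z; have [x <-] := ps z; apply/pE; exists x.
Qed.

Lemma pair_linear (A B C : lmodType R) (f : {linear A -> B}) (g : {linear A -> C}) :
  exists h : {linear A -> (B * C)%type}, forall x, h x = (f x, g x).
Proof. by apply: linear_of_fun => a x y; rewrite !linearP. Qed.

Lemma copair_linear (A B C : lmodType R) (f : {linear A -> C}) (g : {linear B -> C}) :
  exists h : {linear (A * B)%type -> C}, forall x, h x = f x.1 + g x.2.
Proof.
apply: linear_of_fun => a x y.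
by rewrite !linearP /= scalerDr addrACA.
Qed.

Lemma prod_linear (A B C D : lmodType R) (f : {linear A -> C}) (g : {linear B -> D}) :
  exists h : {linear (A * B)%type -> (C * D)%type}, forall x, h x = (f x.1, g x.2).
Proof. exact: pair_linear (f \o fst) (g \o snd). Qed.

Lemma inl_linear (A B : lmodType R) :
  exists h : {linear A -> (A * B)%type}, forall x, h x = (x, 0).
Proof. exact: pair_linear idfun \0. Qed.

Lemma inr_linear (A B : lmodType R) :
  exists h : {linear B -> (A * B)%type}, forall x, h x = (0, x).
Proof. exact: pair_linear \0 idfun. Qed.

Lemma linear_injP (A B : lmodType R) (f : {linear A -> B}) :
  (forall x, f x = 0 -> x = 0) <-> injective f.
Proof.
split=> [f0|fi x fx]; first exact: raddf_inj.
by apply: fi; rewrite fx linear0.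
Qed.

Lemma exact_comp0 (A B C : lmodType R) (f : {linear A -> B}) (g : {linear B -> C}) x :
  exact_at f g -> g (f x) = 0.
Proof. by move=> fg; apply/fg; exists x. Qed.

Lemma short_exact_split (A B : lmodType R) :
  exists (f : {linear A -> (A * B)%type}) (g : {linear (A * B)%type -> B}),
    short_exact f g.
Proof.
have [f fE] := inl_linear A B; exists f, (snd : {linear (A * B)%type -> B}).
split; first by move=> x y; rewrite !fE => -[].
- move=> [x y] /=; split=> [->|[z]]; first by exists x; rewrite fE.
  by rewrite fE => -[].
- by move=> y; exists (0, y).
Qed.

End Toolbox.

(** * Direct sums of copies of a module; free modules *)

Section DirectSum.
Variables (R : pzRingType) (X : eqType) (M : lmodType R).

Definition finite_support : {pred X -> M} :=
  fun f => `[< exists s : seq X, forall x, x \notin s -> f x = 0 >].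

Fact finite_support_closed : GRing.submod_closed finite_support.
Proof.
split=> [|a f g /asboolP[s fs] /asboolP[t gt]]; apply/asboolP.
  by exists [::].
exists (s ++ t) => x; rewrite mem_cat negb_or => /andP[/fs fx /gt gx].
by rewrite [LHS](_ : _ = a *: f x + g x) // fx gx scaler0 addr0.
Qed.

HB.instance Definition _ :=
  GRing.isSubmodClosed.Build R (X -> M) finite_support finite_support_closed.

(** The direct sum of copies of M indexed by X, as the module of finitely supported
functions from X to M; [dsum_coord] and [dsum_inj] are its projections and
injections. *)
Definition dsum := {f : X -> M | finite_support f}.

HB.instance Definition _ := SubType.on dsum.
HB.instance Definition _ := Choice.on dsum.
HB.instance Definition _ := [SubChoice_isSubLmodule of dsum by <:].

Definition dsum_coord (x : X) (u : dsum) : M := \val u x.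

Fact dsum_coord_is_linear x : linear (dsum_coord x).
Proof. by move=> a u v; rewrite /dsum_coord linearP. Qed.

HB.instance Definition _ x :=
  GRing.isLinear.Build R dsum M *:%R (dsum_coord x) (dsum_coord_is_linear x).

Lemma dsum_ext u v : (forall x, dsum_coord x u = dsum_coord x v) -> u = v.
Proof. by move=> uv; apply/val_inj/funext. Qed.

Lemma dsum_supp u : exists s, uniq s /\ forall x, x \notin s -> dsum_coord x u = 0.
Proof.
have /asboolP[s us] := valP u; exists (undup s); split; first exact: undup_uniq.
by move=> x; rewrite mem_undup; exact: us.
Qed.

Lemma dsum_build (f : X -> M) (s : seq X) :
  (forall x, x \notin s -> f x = 0) -> exists u, forall x, dsum_coord x u = f x.
Proof.
move=> fs; have Pf : finite_support f by apply/asboolP; exists s.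
by exists (exist _ f Pf).
Qed.

Lemma dsum_inj_exists x : exists i : {linear M -> dsum},
  forall m y, dsum_coord y (i m) = if y == x then m else 0.
Proof.
apply: (@linear_of_rel R M dsum 
  (fun m u => forall y, dsum_coord y u = if y == x then m else 0)).
- move=> m; apply: (@dsum_build _ [:: x]) => y.
  by rewrite inE => /negPf->.
- by move=> u u0; apply: dsum_ext => y; rewrite u0 if_same linear0.
- move=> a m m' u u' hu hu' y; rewrite linearP /= hu hu'.
  by case: ifP => // _; rewrite scaler0 addr0.
Qed.

Definition dsum_inj x : {linear M -> dsum} := projT1 (cid (dsum_inj_exists x)).

Lemma dsum_injE x m y : dsum_coord y (dsum_inj x m) = if y == x then m else 0.
Proof. by rewrite /dsum_inj; case: cid. Qed.

Lemma dsum_expand u s : uniq s -> (forall x, x \notin s -> dsum_coord x u = 0) ->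
  u = \sum_(x <- s) dsum_inj x (dsum_coord x u).
Proof.
move=> us hs; apply: dsum_ext => y; rewrite linear_sum /=.
have [ys|ys] := boolP (y \in s); last first.
  rewrite hs // big_seq big1 // => x xs; rewrite dsum_injE.
  by case: eqP ys => // ->; rewrite xs.
rewrite (bigD1_seq y) //= dsum_injE eqxx big1 ?addr0 // => x /negPf xy.
by rewrite dsum_injE eq_sym xy.
Qed.

End DirectSum.

Arguments dsum_coord {R X M} x u.
Arguments dsum_inj {R X M} x.

Section DirectSumFunctor.
Variables (R : pzRingType) (X : eqType).

Lemma dsum_map_exists (A B : lmodType R) (f : {linear A -> B}) :
  exists g : {linear dsum X A -> dsum X B},
    forall x u, dsum_coord x (g u) = f (dsum_coord x u).
Proof.
have [|||g gE] := @linear_of_rel R (dsum X A) (dsum X B)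
  (fun u v => forall x, dsum_coord x v = f (dsum_coord x u)); last by exists g.
- move=> u; have [s [_ us]] := dsum_supp u.
  by apply: (@dsum_build _ _ _ _ s) => x /us->; rewrite linear0.
- by move=> v v0; apply: dsum_ext => x; rewrite v0 !linear0.
- by move=> a u u' v v' hv hv' x; rewrite !linearP /= hv hv'.
Qed.

Definition dsum_map (A B : lmodType R) (f : {linear A -> B}) :
  {linear dsum X A -> dsum X B} := projT1 (cid (dsum_map_exists f)).

Lemma dsum_mapE (A B : lmodType R) (f : {linear A -> B}) x u :
  dsum_coord x (dsum_map f u) = f (dsum_coord x u).
Proof. by rewrite /dsum_map; case: cid. Qed.

(** A lift with finite support exists because the lifts of the coordinates outside
the support of v can be taken to be 0. *)
Lemma dsum_lift_supp (A B : lmodType R) (p : {linear A -> B}) (v : dsum X B) :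
  (forall x, exists a, p a = dsum_coord x v) -> exists u, dsum_map p u = v.
Proof.
move=> pv; have [f fE] := choice pv; have [s [_ vs]] := dsum_supp v.
have [|u uE] := @dsum_build R X A (fun x => if x \in s then f x else 0) s.
  by move=> x /negPf->.
exists u; apply: dsum_ext => x; rewrite dsum_mapE uE.
by case: ifPn => [_|/vs->]; rewrite ?fE ?linear0.
Qed.

Lemma dsum_surj (A B : lmodType R) (p : {linear A -> B}) :
  surjective p -> surjective (dsum_map p).
Proof. by move=> ps v; apply: dsum_lift_supp => x; exact: ps. Qed.

Lemma dsum_inj_map (A B : lmodType R) (f : {linear A -> B}) :
  injective f -> injective (dsum_map f).
Proof.
move=> fi u v uv; apply: dsum_ext => x; apply: fi.
by rewrite -!dsum_mapE uv.
Qed.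

Lemma dsum_exact (A B C : lmodType R) (f : {linear A -> B}) (g : {linear B -> C}) :
  exact_at f g -> exact_at (dsum_map f) (dsum_map g).
Proof.
move=> fg v; split=> [gv|[u <-]].
  by apply: dsum_lift_supp => x; apply/fg; rewrite -dsum_mapE gv linear0.
by apply: dsum_ext => x; rewrite !dsum_mapE (exact_comp0 _ fg) linear0.
Qed.

Lemma dsum_short_exact (A B C : lmodType R) (f : {linear A -> B}) (g : {linear B -> C}) :
  short_exact f g -> short_exact (dsum_map f) (dsum_map g).
Proof.
by move=> [? ? ?]; split; [apply: dsum_inj_map|apply: dsum_exact|apply: dsum_surj].
Qed.

Lemma dsum_zero (A : lmodType R) : zero_module A -> zero_module (dsum X A).
Proof. by move=> A0 u; apply: dsum_ext => x; rewrite (A0 (dsum_coord x u)) linear0. Qed.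

Lemma dsum_resolution (C D : lmodType R -> Prop) n (M : lmodType R) :
  (forall P, C P -> D (dsum X P)) ->
  has_resolution C n M -> has_resolution D n (dsum X M).
Proof.
move=> CD [P [d [e [CP P0 es ed dd]]]].
exists (fun i => dsum X (P i)), (fun i => dsum_map (d i)), (dsum_map e); split.
- by move=> i /CP; exact: CD.
- by move=> i /P0; exact: dsum_zero.
- exact: dsum_surj.
- exact: dsum_exact.
- by move=> i; exact: dsum_exact.
Qed.

End DirectSumFunctor.

Arguments dsum_map {R} X {A B} f.

Section FreeModule.
Variable R : pzRingType.

(** The universal property of the free module on X. *)
Lemma free_lift (X : eqType) (M : lmodType R) (g : X -> M) :
  exists h : {linear dsum X (R^o : lmodType R) -> M},
    forall x (r : R), h (dsum_inj x (r : R^o)) = r *: g x.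
Proof.
(* The value at u is a sum over any duplicate-free list containing the support;
   [Teq] shows that it does not depend on the list. *)
pose T (u : dsum X (R^o : lmodType R)) m := exists2 s, uniq s &
  (forall x, x \notin s -> dsum_coord x u = 0) /\
  m = \sum_(x <- s) (dsum_coord x u : R) *: g x.
have Twiden u m (s : seq X) : T u m -> exists t, [/\ uniq t, {subset s <= t},
    forall x, x \notin t -> dsum_coord x u = 0 &
    m = \sum_(x <- t) (dsum_coord x u : R) *: g x].
  move=> [t ut [t0 ->]]; exists (t ++ [seq x <- undup s | x \notin t]); split.
  - rewrite cat_uniq ut filter_uniq ?undup_uniq // andbT /=.
    by apply/hasPn => x; rewrite mem_filter => /andP[].
  - move=> x xs; rewrite mem_cat mem_filter mem_undup xs andbT.
    exact: orbN.
  - by move=> x; rewrite mem_cat negb_or => /andP[/t0].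
  - rewrite big_cat /= [X in _ + X]big_filter [X in _ + X]big1 ?addr0 //.
    by move=> x /t0->; rewrite scale0r.
have Teq u m (s : seq X) : T u m -> uniq s -> (forall x, x \notin s -> dsum_coord x u = 0) ->
    m = \sum_(x <- s) (dsum_coord x u : R) *: g x.
  move=> Tum us s0; have [t [ut st t0 ->]] := Twiden _ _ s Tum.
  rewrite (bigID (fun x => x \in s)) /= [X in _ + X]big1 ?addr0; last first.
    by move=> x /s0->; rewrite scale0r.
  rewrite -big_filter; apply: perm_big; apply: uniq_perm => //.
    exact: filter_uniq.
  by move=> x; rewrite mem_filter andb_idr //; exact: st.
have [|||h hT] := @linear_of_rel R (dsum X (R^o : lmodType R)) M T.
- move=> u; have [s [us s0]] := dsum_supp u.
  by exists (\sum_(x <- s) (dsum_coord x u : R) *: g x), s.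
- by move=> m [s _ [_ ->]]; rewrite big1 // => x _; rewrite linear0 scale0r.
- move=> a u u' m m' Tu Tu'; have [s us [s0 mE]] := Tu.
  have [t [ut st t0 mE']] := Twiden _ _ s Tu'; exists t => //.
  have u0 x : x \notin t -> dsum_coord x u = 0.
    by move=> xt; apply: s0; apply: contra xt; exact: st.
  split=> [x xt|]; first by rewrite linearP /= u0 // t0 // scaler0 addr0.
  rewrite (Teq _ _ _ Tu ut u0) mE' scaler_sumr -big_split /=.
  by apply: eq_bigr => x _; rewrite linearP scalerDl scalerA.
exists h => x r; rewrite (Teq _ _ [:: x] (hT _)) //; last first.
  by move=> y; rewrite inE dsum_injE => /negPf->.
by rewrite big_seq1 dsum_injE eqxx.
Qed.

Lemma free_projective (X : eqType) : projective_module (dsum X (R^o : lmodType R)).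
Proof.
move=> A B p g ps.
have [a aE] := choice (fun x => ps (g (dsum_inj x (1 : R^o)))).
have [h hE] := free_lift a; exists h => u.
have [s [us s0]] := dsum_supp u.
rewrite (dsum_expand us s0) !linear_sum; apply: eq_bigr => x _ /=.
rewrite hE linearZ aE -linearZ -linearZ; congr (g (dsum_inj x _)).
exact: mulr1.
Qed.

Lemma free_cover (M : lmodType R) :
  exists p : {linear dsum M (R^o : lmodType R) -> M}, surjective p.
Proof.
have [p pE] := free_lift (id : M -> M); exists p => m.
by exists (dsum_inj m (1 : R^o)); rewrite pE scale1r.
Qed.

End FreeModule.

(** * Horseshoe lemmas and pullbacks *)

Section Diagrams.
Variable R : pzRingType.

(** The horseshoe lemma, which needs only the right-hand cover to be projective. *)
Lemma horseshoe (A B C FA FC KA KC : lmodType R)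
    (f : {linear A -> B}) (g : {linear B -> C})
    (iA : {linear KA -> FA}) (pA : {linear FA -> A})
    (iC : {linear KC -> FC}) (pC : {linear FC -> C}) :
  short_exact f g -> short_exact iA pA -> short_exact iC pC ->
  projective_module FC ->
  exists (KB : lmodType R) (iB : {linear KB -> (FA * FC)%type})
         (pB : {linear (FA * FC)%type -> B})
         (f' : {linear KA -> KB}) (g' : {linear KB -> KC}),
    short_exact iB pB /\ short_exact f' g'.
Proof.
move=> [fi fg gs] [iAi iApA pAs] [iCi iCpC pCs] projFC.
have [s sE] := projFC _ _ g pC gs.
have [pB pBE] := copair_linear (f \o pA) s; rewrite /= in pBE.
have [KB [iB [iBi iBpB]]] := kernel_exists pB.
have [u uE] := inl_linear FA FC.
have [k|f' f'E] := @factor_inj _ _ _ _ iB (u \o iA) iBi.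
  by apply/iBpB; rewrite pBE /= uE (exact_comp0 _ iApA) !linear0 addr0.
have gpB y : g (pB y) = pC y.2.
  by rewrite pBE linearD sE (exact_comp0 _ fg) add0r.
have [k|g' g'E] := @factor_inj _ _ _ _ iC (snd \o iB) iCi.
  by apply/iCpC; rewrite /= -gpB (exact_comp0 _ iBpB) linear0.
rewrite /= in f'E g'E.
exists KB, iB, pB, f', g'; split; split=> //.
- move=> b; have [c cE] := pCs (g b).
  have /fg[a aE] : g (b - s c) = 0 by rewrite linearB sE cE subrr.
  have [x xE] := pAs a; exists (x, c).
  by rewrite pBE /= xE aE subrK.
- apply/linear_injP => k f'k; apply: iAi; rewrite linear0.
  by have := f'E k; rewrite f'k linear0 uE => -[].
- move=> k; split=> [g'k|[x <-]]; last first.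
    by apply: iCi; rewrite g'E f'E uE /= linear0.
  have k2 : (iB k).2 = 0 by rewrite -g'E g'k linear0.
  have : pB (iB k) = 0 by exact: exact_comp0.
  rewrite pBE k2 linear0 addr0 -[0](linear0 f) => /fi/iApA[x xE].
  exists x; apply: iBi; rewrite f'E uE xE -k2.
  by case: (iB k).
- move=> k; have /fg[a aE] : g (s (iC k)) = 0 by rewrite sE (exact_comp0 _ iCpC).
  have [x xE] := pAs (- a).
  have /iBpB[y yE] : pB (x, iC k) = 0 by rewrite pBE /= xE linearN aE addNr.
  by exists y; apply: iCi; rewrite g'E yE.
Qed.

(** The pullback of two surjections onto M, as in the proof of Schanuel's lemma. *)
Lemma schanuel (K P K' P' M : lmodType R)
    (i : {linear K -> P}) (p : {linear P -> M})
    (i' : {linear K' -> P'}) (p' : {linear P' -> M}) :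
  short_exact i p -> short_exact i' p' ->
  exists (Q : lmodType R) (a : {linear K -> Q}) (b : {linear Q -> P'})
    (a' : {linear K' -> Q}) (b' : {linear Q -> P}),
    short_exact a b /\ short_exact a' b'.
Proof.
move=> [ii ip ps] [ii' ip' ps'].
have [h hE] := copair_linear p (\- p').
rewrite /= in hE.
have [Q [j [ji jh]]] := kernel_exists h.
have [u uE] := inl_linear P P'; have [v vE] := inr_linear P P'.
have [k|a aE] := @factor_inj _ _ _ _ j (u \o i) ji.
  by apply/jh; rewrite hE /= uE (exact_comp0 _ ip) linear0 subr0.
have [k|a' a'E] := @factor_inj _ _ _ _ j (v \o i') ji.
  by apply/jh; rewrite hE /= vE (exact_comp0 _ ip') linear0 subr0.
rewrite /= in aE a'E.
have jE q : p (j q).1 = p' (j q).2.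
  by apply/eqP; rewrite -subr_eq0 -hE (exact_comp0 _ jh).
exists Q, a, (snd \o j), a', (fst \o j); split; split=> /=.
- apply/linear_injP => k ak; apply: ii; rewrite linear0.
  by have := aE k; rewrite ak linear0 uE => -[].
- move=> q /=; split=> [q2|[x <-]]; last by rewrite aE uE.
  have /ip[x xE] : p (j q).1 = 0 by rewrite jE q2 linear0.
  by exists x; apply: ji; rewrite aE uE xE -q2; case: (j q).
- move=> y; have [x xE] := ps (p' y).
  have /jh[q qE] : h (x, y) = 0 by rewrite hE /= xE subrr.
  by exists q; rewrite /= qE.
- apply/linear_injP => k ak; apply: ii'; rewrite linear0.
  by have := a'E k; rewrite ak linear0 vE => -[].
- move=> q /=; split=> [q1|[x <-]]; last by rewrite a'E vE.
  have /ip'[x xE] : p' (j q).2 = 0 by rewrite -jE q1 linear0.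
  by exists x; apply: ji; rewrite a'E vE xE -q1; case: (j q).
- move=> x; have [y yE] := ps' (p x).
  have /jh[q qE] : h (x, y) = 0 by rewrite hE /= yE subrr.
  by exists q; rewrite /= qE.
Qed.

Lemma injective_horseshoe (A B C EA EC A' C' : lmodType R)
    (f : {linear A -> B}) (g : {linear B -> C})
    (iA : {linear A -> EA}) (pA : {linear EA -> A'})
    (iC : {linear C -> EC}) (pC : {linear EC -> C'}) :
  short_exact f g -> short_exact iA pA -> short_exact iC pC ->
  injective_module EA ->
  exists (B' : lmodType R) (iB : {linear B -> (EA * EC)%type})
         (pB : {linear (EA * EC)%type -> B'})
         (f' : {linear A' -> B'}) (g' : {linear B' -> C'}),
    short_exact iB pB /\ short_exact f' g'.
Proof.
move=> [fi fg gs] [iAi iApA pAs] [iCi iCpC pCs] injEA.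
have [s sE] := injEA _ _ f iA fi.
have [iB iBE] := pair_linear s (iC \o g); rewrite /= in iBE.
have [B' [pB [pBs iBpB]]] := cokernel_exists iB.
have [u uE] := inl_linear EA EC.
have [_ /iApA[a <-]|f' f'E] := @factor_surj _ _ _ _ pA (pB \o u) pAs.
  apply/iBpB; exists (f a).
  by rewrite iBE uE sE (exact_comp0 _ fg) linear0.
have [_ /iBpB[b <-]|g' g'E] := @factor_surj _ _ _ _ pB (pC \o snd) pBs.
  by rewrite iBE /= (exact_comp0 _ iCpC).
rewrite /= in f'E g'E.
exists B', iB, pB, f', g'; split; split=> //.
- apply/linear_injP => b; rewrite iBE => -[sb].
  rewrite -[0 in RHS](linear0 iC) => /iCi/fg[a aE].
  rewrite -aE sE -[0](linear0 iA) in sb.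
  by rewrite -aE (iAi _ _ sb) linear0.
- apply/linear_injP => x; have [a <-] := pAs x.
  rewrite f'E => /iBpB[b]; rewrite uE iBE => -[sb].
  rewrite -[0 in RHS](linear0 iC) => /iCi/fg[c cE].
  by apply/iApA; exists c; rewrite -sE cE.
- move=> x; have [y <-] := pBs x; rewrite g'E; split=> [/iCpC[c cE]|[x' yE]].
    have [b bE] := gs c; exists (pA (y.1 - s b)).
    rewrite f'E uE; apply/eqP; rewrite -subr_eq0 -linearB; apply/eqP/iBpB.
    exists (- b); rewrite iBE !linearN bE cE.
    by case: y {cE} => y1 y2; congr pair; rewrite /= ?sub0r // addrAC subrr sub0r.
  rewrite -g'E -yE; have [a <-] := pAs x'.
  by rewrite f'E g'E uE /= linear0.
- move=> z; have [c <-] := pCs z; exists (pB (0, c)).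
  by rewrite g'E.
Qed.

(** For A in B in E, the sequence B / A -> E / A -> E / B. *)
Lemma cosyzygy_subobject (A B C E B' : lmodType R)
    (f : {linear A -> B}) (g : {linear B -> C})
    (i : {linear B -> E}) (p : {linear E -> B'}) :
  short_exact f g -> short_exact i p ->
  exists (A' : lmodType R) (j : {linear A -> E}) (q : {linear E -> A'})
         (f' : {linear C -> A'}) (g' : {linear A' -> B'}),
    short_exact j q /\ short_exact f' g'.
Proof.
move=> [fi fg gs] [ii ip ps].
have [A' [q [qs jq]]] := cokernel_exists (i \o f).
have [_ /fg[a <-]|f' f'E] := @factor_surj _ _ _ _ g (q \o i) gs.
  by apply/jq; exists a.
have [_ /jq[a <-]|g' g'E] := @factor_surj _ _ _ _ q p qs.
  by apply/ip; exists (f a).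
rewrite /= in f'E.
exists A', (i \o f), q, f', g'; split; split=> //.
- by move=> x y /ii/fi.
- apply/linear_injP => c; have [b <-] := gs c.
  by rewrite f'E => /jq[a /ii <-]; exact: exact_comp0.
- move=> x; have [y <-] := qs x; rewrite g'E; split=> [/ip[b <-]|[c]].
    by exists (g b).
  have [b <-] := gs c; rewrite f'E => bE.
  by rewrite -g'E -bE g'E (exact_comp0 _ ip).
- by move=> z; have [y <-] := ps z; exists (q y); rewrite g'E.
Qed.

End Diagrams.

(** * Resolving classes and relative resolution dimension *)

Section ResolutionDimension.
Variables (R : pzRingType) (C : lmodType R -> Prop).

(** M has a resolution of length at most n by members of C, phrased by recursion on
syzygies; see [resdim_leP] for the comparison with [has_resolution]. *)
Fixpoint resdim_le (n : nat) (M : lmodType R) : Prop :=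
  if n is m.+1 then
    exists (K P : lmodType R) (i : {linear K -> P}) (p : {linear P -> M}),
      [/\ short_exact i p, C P & resdim_le m K]
  else C M.

Hypothesis resC : resolving C.

Lemma resolving_iso (M N : lmodType R) (f : {linear M -> N}) :
  injective f -> surjective f -> C M -> C N.
Proof.
case: resC => _ summC _ _ fi fs CM; have [Z Z0] := zero_module_exists R.
have [h hE] := pair_linear f (\0 : {linear M -> Z}).
apply: (summC M N Z h) => //.
have [g [fK gK]] := linear_inverse fi fs.
exists (fun y => g y.1) => [x|[y z]]; rewrite hE /= ?fK ?gK //.
by congr pair; rewrite [z]Z0.
Qed.

Lemma resolving_zero (Z : lmodType R) : zero_module Z -> C Z.
Proof.
case: resC => projC _ _ _ Z0; apply: projC => A B p g ps.
exists \0 => x; rewrite linear0.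
by rewrite (Z0 x) linear0.
Qed.

Lemma resolving_prod (M N : lmodType R) : C M -> C N -> C (M * N)%type.
Proof.
case: resC => _ _ extC _; have [f [g fg]] := short_exact_split M N.
exact: extC fg.
Qed.

Lemma resolving_free_cover (M : lmodType R) :
  exists (F : lmodType R) (p : {linear F -> M}),
    [/\ projective_module F, C F & surjective p].
Proof.
case: resC => projC _ _ _; have [p ps] := free_cover M.
have projF := free_projective (R := R) (X := M).
by exists (dsum M (R^o : lmodType R)), p; split=> //; exact: projC.
Qed.

Lemma resdim_leP n M : has_resolution C n M <-> resdim_le n M.
Proof.
elim: n M => [|n IHn] M /=; split.
- move=> [P [d [e [CP P0 es ed _]]]].
  apply: (resolving_iso (f := e)) (CP 0%N _) => //.
  by apply/linear_injP => x /ed[y <-]; rewrite (P0 1%N _ y) ?linear0.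
- move=> CM; have [Z Z0] := zero_module_exists R.
  exists (fun i => if i is 0%N then M else Z), (fun i => \0), idfun; split.
  + by case=> [|i].
  + by case=> [|i].
  + by move=> x; exists x.
  + by move=> x; split=> [x0|[y <-]] //; exists 0; symmetry; exact: x0.
  + by move=> i x; split=> // _; exists 0; rewrite /= [x]Z0.
- move=> [P [d [e [CP P0 es ed dd]]]].
  have [K [i [ii ie]]] := kernel_exists e.
  have [y|k kE] := @factor_inj _ _ _ _ i (d 0%N) ii.
    by apply/ie/ed; exists y.
  exists K, (P 0%N), i, e; split=> //; first exact: CP.
  apply/IHn; exists (fun j => P j.+1), (fun j => d j.+1), k; split=> //.
  + by move=> j jn; apply: CP.
  + by move=> j jn; apply: P0.
  + move=> x; have /ed[y yE] : e (i x) = 0 by exact: exact_comp0.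
    by exists y; apply: ii; rewrite kE.
  + by move=> y; rewrite -dd -kE; split=> [->|iky]; [|apply: ii; rewrite iky]; rewrite linear0.
- move=> [K [P0 [i [p [[ii ip ps] CP]]]]] /IHn[P [d [e [CPs Pz es ed dd]]]].
  pose P' j := if j is k.+1 then P k else P0.
  pose d' j : {linear P' j.+1 -> P' j} :=
    match j with 0%N => i \o e | k.+1 => d k end.
  exists P', d', p; split=> //.
  + by case=> [|j] //; exact: CPs.
  + by case=> [|j] //; exact: Pz.
  + move=> x; rewrite ip; split=> [[y <-]|[z <-]]; last by exists (e z).
    by have [z <-] := es y; exists z.
  + case=> [|j] x /=; last exact: dd.
    rewrite -ed; split=> [|->]; last by rewrite linear0.
    by move/linear_injP: ii => ii /ii.
Qed.

Lemma resdim_leS n M : resdim_le n M -> resdim_le n.+1 M.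
Proof.
elim: n M => [|n IHn] M /=; last first.
  move=> [K [P [i [p [ip CP /IHn Kn]]]]].
  by exists K, P, i, p.
move=> CM; have [Z Z0] := zero_module_exists R.
exists Z, M, \0, idfun; split=> //; last exact: resolving_zero.
split.
- by move=> x y _; rewrite [x]Z0 [y]Z0.
- by move=> x; split=> [x0|[y <-]] //; exists 0; symmetry; exact: x0.
- by move=> x; exists x.
Qed.

Lemma resdim_le_mono m n M : (m <= n)%N -> resdim_le m M -> resdim_le n M.
Proof.
move=> /subnK <-; elim: (n - m)%N => // k IHk /IHk; exact: resdim_leS.
Qed.

Lemma resdim_le_of n M : C M -> resdim_le n M.
Proof. exact: (@resdim_le_mono 0%N). Qed.

(** Closure of C-dimension at most n under extensions and kernels of surjections,
and the independence of syzygies from the chosen cover. The three are proved by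
a simultaneous induction: the third at n follows from the first two at n, and
gives the first two at n+1 through the horseshoe lemma. *)
Lemma resdim_closed n :
  [/\ forall (A B D : lmodType R) (f : {linear A -> B}) (g : {linear B -> D}),
        short_exact f g -> resdim_le n A -> resdim_le n D -> resdim_le n B,
      forall (A B D : lmodType R) (f : {linear A -> B}) (g : {linear B -> D}),
        short_exact f g -> resdim_le n B -> resdim_le n D -> resdim_le n A
    & forall (K P M : lmodType R) (i : {linear K -> P}) (p : {linear P -> M}),
        short_exact i p -> C P -> resdim_le n.+1 M -> resdim_le n K].
Proof.
elim: n => [|n [extn kern syzn]].
  have [_ _ extC kerC] := resC; split=> // K P M i p ip CP.
  move=> [K' [P' [i' [p' [ip' CP' CK']]]]].
  have [Q [a [b [a' [b' [ab a'b']]]]]] := schanuel ip ip'.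
  by apply: kerC ab _ CP'; exact: extC a'b' CK' CP.
have extS (A B D : lmodType R) (f : {linear A -> B}) (g : {linear B -> D}) :
    short_exact f g -> resdim_le n.+1 A -> resdim_le n.+1 D -> resdim_le n.+1 B.
  move=> fg An Dn.
  have [FA [pA [_ CFA pAs]]] := resolving_free_cover A.
  have [FD [pD [projFD CFD pDs]]] := resolving_free_cover D.
  have [KA [iA [iAi iApA]]] := kernel_exists pA.
  have [KD [iD [iDi iDpD]]] := kernel_exists pD.
  have sA : short_exact iA pA by [].
  have sD : short_exact iD pD by [].
  have [KB [iB [pB [f' [g' [sB s']]]]]] := horseshoe fg sA sD projFD.
  exists KB, (FA * FD)%type, iB, pB; split=> //; first exact: resolving_prod.
  by apply: extn s' _ _; [exact: syzn sA _ An|exact: syzn sD _ Dn].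
have kerS (A B D : lmodType R) (f : {linear A -> B}) (g : {linear B -> D}) :
    short_exact f g -> resdim_le n.+1 B -> resdim_le n.+1 D -> resdim_le n.+1 A.
  move=> fg Bn Dn.
  have [FA [pA [_ CFA pAs]]] := resolving_free_cover A.
  have [FD [pD [projFD CFD pDs]]] := resolving_free_cover D.
  have [KA [iA [iAi iApA]]] := kernel_exists pA.
  have [KD [iD [iDi iDpD]]] := kernel_exists pD.
  have sA : short_exact iA pA by [].
  have sD : short_exact iD pD by [].
  have [KB [iB [pB [f' [g' [sB s']]]]]] := horseshoe fg sA sD projFD.
  exists KA, FA, iA, pA; split=> //.
  apply: kern s' _ _; last exact: syzn sD _ Dn.
  by apply: syzn sB _ Bn; exact: resolving_prod.
split=> // K P M i p ip CP [K' [P' [i' [p' [ip' CP' K'n]]]]].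
(* Q is an extension of P by K', and K is the kernel of Q -> P'. *)
have [Q [a [b [a' [b' [ab a'b']]]]]] := schanuel ip ip'.
apply: kerS ab _ _; last exact: resdim_le_of.
by apply: extS a'b' _ _ => //; exact: resdim_le_of.
Qed.

Lemma resdim_summand n (M N N' : lmodType R) (phi : {linear M -> (N * N')%type}) :
  bijective phi -> resdim_le n M -> resdim_le n N.
Proof.
elim: n M N N' phi => [|n IHn] M N N' phi bij_phi.
  by case: resC => _ summC _ _; exact: summC bij_phi.
have [phi' phiK phi'K] := bij_phi.
have [psi [psiK psi'K]] : exists psi : {linear (N * N')%type -> M},
    cancel phi psi /\ cancel psi phi.
  apply: linear_inverse; first exact: bij_inj.
  by move=> y; exists (phi' y); rewrite phi'K.
move=> Mn.
have [F [p [_ CF ps]]] := resolving_free_cover N.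
have [F' [p' [_ CF' ps']]] := resolving_free_cover N'.
have [K [i [ii ip]]] := kernel_exists p.
have [K' [i' [ii' ip']]] := kernel_exists p'.
have [j jE] := prod_linear i i'; have [q qE] := prod_linear p p'.
exists K, F, i, p; split=> //.
apply: (IHn (K * K')%type K K' idfun); first by exists id.
have [_ _ syz] := resdim_closed n.
apply: (syz _ (F * F')%type M j (psi \o q)) Mn; last exact: resolving_prod.
split.
- by move=> [x x'] [y y']; rewrite !jE => -[/ii-> /ii'->].
- move=> [x x'] /=; rewrite qE /=; split=> [/eqP|[[y y']]]; last first.
    rewrite jE => -[<- <-] /=; rewrite (exact_comp0 _ ip) (exact_comp0 _ ip').
    exact: (linear0 psi).
  rewrite -[0 in X in X -> _](linear0 psi) => /eqP/(can_inj psi'K)[].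
  by move=> /ip[y <-] /ip'[y' <-]; exists (y, y'); rewrite jE.
- move=> m; have [x xE] := ps (phi m).1; have [x' xE'] := ps' (phi m).2.
  by exists (x, x'); rewrite /= qE /= xE xE' -[RHS]psiK; case: (phi m).
Qed.

Lemma resdim_prod n (M N : lmodType R) :
  resdim_le n M -> resdim_le n N -> resdim_le n (M * N)%type.
Proof.
have [f [g fg]] := short_exact_split M N.
by have [ext _ _] := resdim_closed n; exact: ext fg.
Qed.

Theorem finite_resdim_resolving :
  resolving (fun M => exists m, has_resolution C m M).
Proof.
split.
- move=> P projP; exists 0%N; apply/resdim_leP.
  by case: resC => projC _ _ _; exact: projC.
- move=> M N N' phi bij_phi [m /resdim_leP Mm]; exists m; apply/resdim_leP.
  exact: resdim_summand bij_phi Mm.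
- move=> A B D f g fg [m /resdim_leP Am] [n /resdim_leP Dn].
  exists (maxn m n); apply/resdim_leP; have [ext _ _] := resdim_closed (maxn m n).
  by apply: ext fg _ _; [apply: resdim_le_mono Am|apply: resdim_le_mono Dn];
    rewrite ?leq_maxl ?leq_maxr.
- move=> A B D f g fg [m /resdim_leP Bm] [n /resdim_leP Dn].
  exists (maxn m n); apply/resdim_leP; have [_ ker _] := resdim_closed (maxn m n).
  by apply: ker fg _ _; [apply: resdim_le_mono Bm|apply: resdim_le_mono Dn];
    rewrite ?leq_maxl ?leq_maxr.
Qed.

End ResolutionDimension.

(** * Right exactness of the tensor product *)

Section TensorTheory.
Variable R : pzRingType.
Local Open Scope quotient_scope.

Lemma tensor_lift_exists (A : lmodType R^c) (M : lmodType R) (G : zmodType)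
    (b : A -> M -> G) : balanced b ->
  exists h : {additive tensor A M -> G}, forall a m, h (tens a m) = b a m.
Proof.
move=> bal_b.
pose h : {additive tensor A M -> G} := HB.pack (tensor_lift b)
  (GRing.isZmodMorphism.Build _ _ _ (tensor_lift_is_zmod_morphism bal_b)).
by exists h => a m; exact: (tensor_liftE bal_b).
Qed.

Lemma tensor_ind (A : lmodType R^c) (M : lmodType R) (P : tensor A M -> Prop) :
  P 0 -> (forall u v, P u -> P v -> P (u - v)) -> (forall a m, P (tens a m)) ->
  forall u, P u.
Proof.
move=> P0 PB Pt u; rewrite -[u]reprK.
pose p (x : {freeg (A * M)%type / int}) : tensor A M := \pi_(tensor A M) x.
have pB : zmod_morphism p by move=> x y; rewrite /p !piE.
pose q : {additive {freeg (A * M)%type / int} -> tensor A M} :=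
  HB.pack p (GRing.isZmodMorphism.Build _ _ _ pB).
have PN x : P x -> P (- x) by move=> Px; rewrite -sub0r; exact: PB.
have PD x y : P x -> P y -> P (x + y).
  by move=> Px Py; rewrite -[y]opprK; apply: PB => //; exact: PN.
have PMn x n : P x -> P (x *+ n).
  by move=> Px; elim: n => [|n IHn]; rewrite ?mulr0n ?mulrSr //; exact: PD.
suff : P (q (repr u)) by [].
elim/freeg_ind_dom0: (repr u) => [|k [a m] D _ _ IHD].
  by rewrite raddf0.
rewrite raddfD; apply: PD => //.
rewrite -[k]intz -freegU_mulz raddfMz.
have Pq : P (q (<< (a, m) >> : {freeg (A * M)%type / int})) by exact: Pt.
case: k => n; first exact: PMn.
by rewrite NegzE mulrNz; exact/PN/PMn.
Qed.

Lemma tensor_additive_ext (A : lmodType R^c) (M : lmodType R) (G : zmodType)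
    (f g : {additive tensor A M -> G}) :
  (forall a m, f (tens a m) = g (tens a m)) -> f =1 g.
Proof.
move=> fg; apply: tensor_ind => [|u v fu fv|//]; first by rewrite !raddf0.
by rewrite !raddfB fu fv.
Qed.

Lemma tensl_is_zmod_morphism (A : lmodType R^c) (M : lmodType R) (m : M) :
  zmod_morphism (fun a : A => tens a m).
Proof.
have [tDl _ _] := tens_balanced A M.
by move=> x y; apply/eqP; rewrite eq_sym subr_eq -tDl subrK.
Qed.

Lemma tensr_is_zmod_morphism (A : lmodType R^c) (M : lmodType R) (a : A) :
  zmod_morphism (fun m : M => tens a m).
Proof.
have [_ tDr _] := tens_balanced A M.
by move=> x y; apply/eqP; rewrite eq_sym subr_eq -tDr subrK.
Qed.

Lemma tens_suml (A : lmodType R^c) (M : lmodType R) (I : Type) (s : seq I)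
    (F : I -> A) (m : M) :
  tens (\sum_(i <- s) F i) m = \sum_(i <- s) tens (F i) m.
Proof.
pose T : {additive A -> tensor A M} := HB.pack (fun a => tens a m)
  (GRing.isZmodMorphism.Build _ _ _ (tensl_is_zmod_morphism m)).
exact: (raddf_sum T).
Qed.

Lemma tens_sumr (A : lmodType R^c) (M : lmodType R) (I : Type) (s : seq I)
    (a : A) (F : I -> M) :
  tens a (\sum_(i <- s) F i) = \sum_(i <- s) tens a (F i).
Proof.
pose T : {additive M -> tensor A M} := HB.pack (fun m => tens a m)
  (GRing.isZmodMorphism.Build _ _ _ (tensr_is_zmod_morphism a)).
exact: (raddf_sum T).
Qed.

Lemma tens0l (A : lmodType R^c) (M : lmodType R) (m : M) : tens (0 : A) m = 0.
Proof. by have := tensl_is_zmod_morphism m 0 (0 : A); rewrite !subrr. Qed.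

Lemma tens0r (A : lmodType R^c) (M : lmodType R) (a : A) : tens a (0 : M) = 0.
Proof. by have := tensr_is_zmod_morphism a 0 (0 : M); rewrite !subrr. Qed.

Section RightFunctoriality.
Variables (A : lmodType R^c) (M N : lmodType R) (g : {linear M -> N}).

Fact tensor_mapr_exists : exists h : {additive tensor A M -> tensor A N},
  forall a m, h (tens a m) = tens a (g m).
Proof.
apply: tensor_lift_exists; have [tDl tDr tZ] := tens_balanced A N.
by split=> *; rewrite ?linearD ?linearZ ?tDl ?tDr ?tZ.
Qed.

(** The map induced on A (x) M by a linear map out of M. *)
Definition tensor_mapr : {additive tensor A M -> tensor A N} :=
  projT1 (cid tensor_mapr_exists).

Lemma tensor_maprE a m : tensor_mapr (tens a m) = tens a (g m).
Proof. by rewrite /tensor_mapr; case: cid. Qed.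

End RightFunctoriality.

Lemma tensor_map_mapr (A B : lmodType R^c) (M N : lmodType R)
    (f : {linear A -> B}) (g : {linear M -> N}) u :
  tensor_map f N (tensor_mapr A g u) = tensor_mapr B g (tensor_map f M u).
Proof.
apply: (tensor_additive_ext (f := tensor_map f N \o tensor_mapr A g)
  (g := tensor_mapr B g \o tensor_map f M)) => a m.
by rewrite /= !(tensor_mapE, tensor_maprE).
Qed.

Lemma tensor_mapr_comp (A : lmodType R^c) (L M N : lmodType R)
    (f : {linear L -> M}) (g : {linear M -> N}) u :
  tensor_mapr A g (tensor_mapr A f u) = tensor_mapr A (g \o f) u.
Proof.
apply: (tensor_additive_ext (f := tensor_mapr A g \o tensor_mapr A f)) => a m.
by rewrite /= !tensor_maprE.
Qed.

Lemma tensor_mapr_id (A : lmodType R^c) (M : lmodType R) (f : {linear M -> M}) u :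
  f =1 id -> tensor_mapr A f u = u.
Proof.
move=> f1; apply: (tensor_additive_ext (g := idfun)) => a m.
by rewrite tensor_maprE f1.
Qed.

Lemma tensor_mapr0 (A : lmodType R^c) (L M : lmodType R) (f : {linear L -> M}) u :
  (forall x, f x = 0) -> tensor_mapr A f u = 0.
Proof.
move=> f0; apply: (tensor_additive_ext (g := \0)) => a m.
by rewrite tensor_maprE f0 tens0r.
Qed.

Lemma zmod_quotient_exists (G : zmodType) (S : G -> Prop) :
  S 0 -> (forall x y, S x -> S y -> S (x - y)) ->
  exists (Q : zmodType) (p : {additive G -> Q}), forall x, p x = 0 <-> S x.
Proof.
move=> S0 SB; pose P : {pred G} := fun x => `[< S x >].
have P_closed : zmod_closed P.
  by split=> [|x y /asboolP Sx /asboolP Sy]; apply/asboolP => //; exact: SB.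
pose Pc : zmodClosed G := HB.pack P (GRing.isZmodClosed.Build G P P_closed).
pose Q : zmodType := Quotient.quot Pc.
pose p (x : G) : Q := \pi_(Quotient.quot Pc) x.
have pB : zmod_morphism p by move=> x y; rewrite /p !piE.
pose q : {additive G -> Q} := HB.pack p (GRing.isZmodMorphism.Build _ _ _ pB).
exists Q, q => x; have -> : (0 : Q) = q 0 by rewrite raddf0.
have pE : (q x == q 0) = P x.
  by rewrite -[LHS]/(p x == p 0) /p -Quotient.idealrBE subr0.
by split=> [/eqP|Sx]; [|apply/eqP]; rewrite pE; [move/asboolP|exact/asboolP].
Qed.

(** Exactness of - (x) M at the middle term: modulo the image of f the tensor of a
lift to B depends only on its image in C, which defines an inverse on C (x) M. *)
Lemma tensor_right_exactl (A B C : lmodType R^c) (f : {linear A -> B})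
    (g : {linear B -> C}) (M : lmodType R) (u : tensor B M) :
  surjective g -> exact_at f g -> tensor_map g M u = 0 ->
  exists v, tensor_map f M v = u.
Proof.
move=> gs fg gu.
have [|x y [v <-] [w <-]|Q [p pE]] :=
    @zmod_quotient_exists (tensor B M) (fun u => exists v, tensor_map f M v = u).
- by exists 0; rewrite raddf0.
- by exists (v - w); rewrite raddfB.
have [s sE] := choice gs.
have [tDl tDr tZ] := tens_balanced B M.
have p_eq x y m : g x = g y -> p (tens x m) = p (tens y m).
  move=> gxy; have /fg[a aE] : g (x - y) = 0 by rewrite linearB gxy subrr.
  rewrite -[x](subrK y) tDl raddfD -aE -(tensor_mapE f).
  have -> : p (tensor_map f M (tens a m)) = 0 by apply/pE; exists (tens a m).
  exact: add0r.
have [|h hE] := @tensor_lift_exists C M Q (fun x m => p (tens (s x) m)).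
  split=> [a a' m|a m m'|r a m].
  - by rewrite -raddfD -tDl; apply: p_eq; rewrite sE linearD !sE.
  - by rewrite -raddfD -tDr.
  - by rewrite -tZ; apply: p_eq; rewrite sE linearZ /= sE.
apply/pE; suff -> : p u = h (tensor_map g M u) by rewrite gu raddf0.
apply: (tensor_additive_ext (g := h \o tensor_map g M)) => b m /=.
by rewrite tensor_mapE hE; apply: p_eq; rewrite sE.
Qed.

(** The same for A (x) -. *)
Lemma tensor_right_exactr (A : lmodType R^c) (L M N : lmodType R)
    (f : {linear L -> M}) (g : {linear M -> N}) (u : tensor A M) :
  surjective g -> exact_at f g -> tensor_mapr A g u = 0 ->
  exists v, tensor_mapr A f v = u.
Proof.
move=> gs fg gu.
have [|x y [v <-] [w <-]|Q [p pE]] :=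
    @zmod_quotient_exists (tensor A M) (fun u => exists v, tensor_mapr A f v = u).
- by exists 0; rewrite raddf0.
- by exists (v - w); rewrite raddfB.
have [s sE] := choice gs.
have [tDl tDr tZ] := tens_balanced A M.
have p_eq a x y : g x = g y -> p (tens a x) = p (tens a y).
  move=> gxy; have /fg[l lE] : g (x - y) = 0 by rewrite linearB gxy subrr.
  rewrite -[x](subrK y) tDr raddfD -lE -(tensor_maprE f).
  have -> : p (tensor_mapr A f (tens a l)) = 0 by apply/pE; exists (tens a l).
  exact: add0r.
have [|h hE] := @tensor_lift_exists A N Q (fun a x => p (tens a (s x))).
  split=> [a a' m|a m m'|r a m].
  - by rewrite -raddfD -tDl.
  - by rewrite -raddfD -tDr; apply: p_eq; rewrite sE linearD !sE.
  - by rewrite tZ; apply: p_eq; rewrite sE linearZ /= sE.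
apply/pE; suff -> : p u = h (tensor_mapr A g u) by rewrite gu raddf0.
apply: (tensor_additive_ext (g := h \o tensor_mapr A g)) => b m /=.
by rewrite tensor_maprE hE; apply: p_eq; rewrite sE.
Qed.

End TensorTheory.

(** * Flat modules form a resolving class *)

Section Flatness.
Variable R : pzRingType.

Lemma flat_retract (M N : lmodType R) (i : {linear M -> N}) (r : {linear N -> M}) :
  cancel i r -> flat_module N -> flat_module M.
Proof.
move=> iK flatN A B f fi; apply: raddf_inj => u fu.
have : tensor_mapr A i u = 0.
  by apply: (flatN A B f fi); rewrite tensor_map_mapr fu !raddf0.
move=> iu; rewrite -(@tensor_mapr_id R A M (r \o i) u iK) -tensor_mapr_comp.
by rewrite iu raddf0.
Qed.

(** Each element of A (x) M^(X) is the sum of its components in the copies of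
A (x) M, over every list of indices that is large enough. *)
Lemma tensor_dsum_expand (A : lmodType R^c) (X : eqType) (M : lmodType R)
    (u : tensor A (dsum X M)) :
  exists s : seq X, forall t, uniq t -> {subset s <= t} ->
    u = \sum_(x <- t) tensor_mapr A (dsum_inj x) (tensor_mapr A (dsum_coord x) u).
Proof.
elim/tensor_ind: u => [|u v [s us] [t vt]|a f].
- by exists [::] => t _ _; rewrite big1 // => x _; rewrite !raddf0.
- exists (s ++ t) => w uw sw.
  have sl x : x \in s -> x \in s ++ t by rewrite mem_cat => ->.
  have sr x : x \in t -> x \in s ++ t by rewrite mem_cat orbC => ->.
  have uE := us w uw (fun x xs => sw x (sl x xs)).
  have vE := vt w uw (fun x xt => sw x (sr x xt)).
  pose c (z : tensor A (dsum X M)) (x : X) : tensor A (dsum X M) :=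
    tensor_mapr A (dsum_inj x) (tensor_mapr A (dsum_coord x) z).
  transitivity (\sum_(x <- w) c u x - \sum_(x <- w) c v x).
    by congr (_ - _).
  by rewrite -sumrB; apply: eq_bigr => x _; rewrite /c !raddfB.
- have [s [us fs]] := dsum_supp f; exists s => t ut st.
  rewrite {1}(@dsum_expand _ _ _ f t) // => [|x xt].
    by rewrite tens_sumr; apply: eq_bigr => x _; rewrite !tensor_maprE.
  by apply: fs; apply: contra xt; exact: st.
Qed.

Lemma flat_dsum (X : eqType) (M : lmodType R) :
  flat_module M -> flat_module (dsum X M).
Proof.
move=> flatM A B f fi; apply: raddf_inj => u fu.
have [s /(_ (undup s) (undup_uniq s)) ->] := tensor_dsum_expand u; last first.
  by move=> x; rewrite mem_undup.
apply: big1 => x _; have -> : tensor_mapr A (dsum_coord x) u = 0.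
  by apply: (flatM A B f fi); rewrite tensor_map_mapr fu !raddf0.
by rewrite raddf0.
Qed.

Lemma flat_regular : flat_module (R^o : lmodType R).
Proof.
have cP (A : lmodType R^c) : exists c : {additive tensor A (R^o : lmodType R) -> A},
    forall a (r : R^o), c (tens a r) = (r : R^c) *: a.
  apply: tensor_lift_exists; split=> [a a' r|a r r'|s a r].
  - exact: scalerDr.
  - exact: scalerDl.
  - by rewrite scalerA.
move=> A B f fi; apply: raddf_inj => u fu.
have [c cE] := cP A; have [d dE] := cP B.
have ucE : u = tens (c u) (1 : R^o).
  have [_ _ tZ] := tens_balanced A (R^o : lmodType R).
  pose T : {additive A -> tensor A (R^o : lmodType R)} :=
    HB.pack (fun a : A => tens a (1 : R^o))
      (GRing.isZmodMorphism.Build _ _ _ (tensl_is_zmod_morphism (1 : R^o))).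
  apply: (tensor_additive_ext (f := idfun) (g := T \o c)) => a r /=.
  by rewrite cE tZ; congr tens; rewrite /GRing.scale /= mulr1.
have dcE : d (tensor_map f _ u) = f (c u).
  apply: (tensor_additive_ext (f := d \o tensor_map f _) (g := f \o c)) => a r /=.
  by rewrite tensor_mapE dE cE linearZ.
have cu : c u = 0 by apply: fi; rewrite -dcE fu !raddf0.
by rewrite ucE cu tens0l.
Qed.

Lemma flat_projective (P : lmodType R) : projective_module P -> flat_module P.
Proof.
move=> projP; have [p ps] := free_cover P.
have [h hE] := projP _ _ p idfun ps.
by apply: (flat_retract hE); apply: flat_dsum; exact: flat_regular.
Qed.

(** An element of F (x) M, with F the free right module on X, is the sum of its
components e_x (x) c_x, where e_x is the basis element of index x and c_x is
given by the maps [c]. *)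
Lemma tensor_free_expand (X : eqType) (M : lmodType R)
    (c : forall x, {additive tensor (dsum X (R^c^o : lmodType R^c)) M -> M})
    (cE : forall x f m, c x (tens f m) = (dsum_coord x f : R) *: m)
    (u : tensor (dsum X (R^c^o : lmodType R^c)) M) :
  exists s : seq X, forall t, uniq t -> {subset s <= t} ->
    u = \sum_(x <- t) tens (dsum_inj x (1 : R^c^o)) (c x u).
Proof.
have [tDl tDr tZ] := tens_balanced (dsum X (R^c^o : lmodType R^c)) M.
elim/tensor_ind: u => [|u v [s us] [t vt]|f m].
- by exists [::] => t _ _; rewrite big1 // => x _; rewrite raddf0 tens0r.
- exists (s ++ t) => w uw sw.
  have sl x : x \in s -> x \in s ++ t by rewrite mem_cat => ->.
  have sr x : x \in t -> x \in s ++ t by rewrite mem_cat orbC => ->.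
  have uE := us w uw (fun x xs => sw x (sl x xs)).
  have vE := vt w uw (fun x xt => sw x (sr x xt)).
  transitivity (\sum_(x <- w) tens (dsum_inj x (1 : R^c^o)) (c x u) -
    \sum_(x <- w) tens (dsum_inj x (1 : R^c^o)) (c x v)).
    by congr (_ - _).
  rewrite -sumrB; apply: eq_bigr => x _; rewrite raddfB.
  by apply/eqP; rewrite subr_eq -tDr subrK.
- have [s [us fs]] := dsum_supp f; exists s => t ut st.
  rewrite {1}(@dsum_expand _ _ _ f t) // => [|x xt]; last first.
    by apply: fs; apply: contra xt; exact: st.
  rewrite tens_suml; apply: eq_bigr => x _; rewrite cE -tZ -linearZ.
  congr (tens (dsum_inj x _) m).
  by rewrite /GRing.scale /= mulr1.
Qed.

Lemma tensor_free_inj (X : eqType) (M N : lmodType R) (g : {linear M -> N}) :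
  injective g -> injective (tensor_mapr (dsum X (R^c^o : lmodType R^c)) g).
Proof.
set F := dsum X _ => gi.
have cP (K : lmodType R) : exists c : forall x : X, {additive tensor F K -> K},
    forall x f k, c x (tens f k) = (dsum_coord x f : R) *: k.
  have cx x : exists c : {additive tensor F K -> K},
      forall f k, c (tens f k) = (dsum_coord x f : R) *: k.
    apply: tensor_lift_exists; split=> [f f' k|f k k'|r f k].
    - by rewrite linearD scalerDl.
    - exact: scalerDr.
    - by rewrite linearZ scalerA.
  have [c cE] := choice cx; by exists c.
have [c cE] := cP M; have [d dE] := cP N.
apply: raddf_inj => u gu.
have cu x : c x u = 0.
  apply: gi; rewrite linear0 -[RHS](raddf0 (d x)) -gu.
  apply: (tensor_additive_ext (f := g \o c x) (g := d x \o tensor_mapr F g)).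
  by move=> f m /=; rewrite cE tensor_maprE dE linearZ.
have [s /(_ (undup s) (undup_uniq s)) ->] := tensor_free_expand cE u; last first.
  by move=> x; rewrite mem_undup.
by apply: big1 => x _; rewrite cu tens0r.
Qed.

(** The vanishing of Tor_1 (B, M) for M flat. The proof is a chase in the diagram
of the tensor products of B' -> F -> B with K -> L -> M, with F free. *)
Lemma flat_quotient_tensor_inj (K L M : lmodType R) (i : {linear K -> L})
    (p : {linear L -> M}) (B : lmodType R^c) :
  short_exact i p -> flat_module M -> injective (tensor_mapr B i).
Proof.
move=> [ii ip ps] flatM; apply: raddf_inj => x ix.
have [q qs] := free_cover B.
have [B' [j [ji jq]]] := kernel_exists q.
have [x' x'E] : exists x', tensor_map q K x' = x.
  elim/tensor_ind: {ix} x => [|u v [u' <-] [v' <-]|b k].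
  - by exists 0; rewrite raddf0.
  - by exists (u' - v'); rewrite raddfB.
  - by have [f <-] := qs b; exists (tens f k); rewrite tensor_mapE.
have [y yE] : exists y, tensor_map j L y = tensor_mapr _ i x'.
  by apply: (tensor_right_exactl qs jq); rewrite tensor_map_mapr x'E.
have [z zE] : exists z, tensor_mapr B' i z = y.
  apply: (tensor_right_exactr ps ip); apply: (flatM _ _ j ji).
  rewrite tensor_map_mapr yE tensor_mapr_comp tensor_mapr0 ?raddf0 // => k.
  exact: exact_comp0.
have zx' : tensor_map j K z = x'.
  by apply: (tensor_free_inj ii); rewrite -tensor_map_mapr zE yE.
rewrite -x'E -zx'.
apply: (tensor_additive_ext (f := tensor_map q K \o tensor_map j K) (g := \0)) => a k.
by rewrite /= !tensor_mapE (exact_comp0 _ jq) tens0l.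
Qed.

Lemma flat_resolving : resolving (@flat_module R).
Proof.
split; first exact: flat_projective.
- move=> M N N' phi bij_phi flatM; have [phi' phiK phi'K] := bij_phi.
  have [|y|psi [psiK psi'K]] := @linear_inverse R _ _ phi.
  + exact: bij_inj.
  + by exists (phi' y); rewrite phi'K.
  have [u uE] := inl_linear N N'.
  apply: (@flat_retract N M (psi \o u) (fst \o phi)) flatM => x.
  by rewrite /= psi'K uE.
- move=> K L M i p ip flatK flatM A B f fi; have [ii iip ps] := ip.
  apply: raddf_inj => u fu.
  have [v vE] : exists v, tensor_mapr A i v = u.
    apply: (tensor_right_exactr ps iip); apply: (flatM _ _ f fi).
    by rewrite tensor_map_mapr fu !raddf0.
  suff v0 : v = 0 by rewrite -vE v0 raddf0.
  apply: (flatK _ _ f fi); apply: (flat_quotient_tensor_inj ip flatM).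
  by rewrite -tensor_map_mapr vE fu !raddf0.
- move=> K L M i p ip flatL flatM A B f fi; apply: raddf_inj => u fu.
  apply: (flat_quotient_tensor_inj ip flatM); apply: (flatL _ _ f fi).
  by rewrite tensor_map_mapr fu !raddf0.
Qed.

End Flatness.

(** * Injective modules *)

Section Injectivity.
Local Open Scope classical_set_scope.

(** Zorn's lemma for sets ordered by inclusion, above a given set. *)
Lemma zorn_above (T : Type) (P : set (set T)) (S0 : set T) :
  P S0 ->
  (forall F : set (set T), F `<=` P -> F !=set0 -> total_on F subset ->
    P (\bigcup_(X in F) X)) ->
  exists A, [/\ P A, S0 `<=` A & forall B, P B -> A `<=` B -> B `<=` A].
Proof.
move=> PS0 Pchain.
pose U := {A : set T | P A /\ S0 `<=` A}.
pose t0 : U := exist _ S0 (conj PS0 (@subset_refl _ S0)).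
pose r (A B : U) := `[< sval A `<=` sval B >].
have [||F Ftot|[A [PA SA]] Amax] := @ZL_preorder U t0 r.
- by move=> A; apply/asboolP.
- by move=> A B C /asboolP AB /asboolP BC; apply/asboolP; exact: subset_trans BC.
- have [[A0 FA0]|F0] := pselect (F !=set0); last first.
    by exists t0 => A FA; case: F0; exists A.
  pose F' : set (set T) := [set sval A | A in F].
  have PF' : P (\bigcup_(X in F') X).
    apply: Pchain.
    - by move=> _ [A FA <-]; case: (svalP A).
    - by exists (sval A0), A0.
    - by move=> _ _ [A FA <-] [B FB <-]; have [/asboolP ?|/asboolP ?] := Ftot _ _ FA FB;
        [left|right].
  have SF' : S0 `<=` \bigcup_(X in F') X.
    move=> x S0x; exists (sval A0); first by exists A0.
    by case: (svalP A0) => _; exact.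
  exists (exist (fun A => P A /\ S0 `<=` A) _ (conj PF' SF')) => A FA; apply/asboolP => x Ax /=.
  by exists (sval A) => //; exists A.
exists A; split=> // B PB AB.
have SB : S0 `<=` B by exact: subset_trans AB.
exact: (asboolW (Amax (exist (fun A => P A /\ S0 `<=` A) B (conj PB SB)) (asboolT AB))).
Qed.

Lemma is_submod_chain (R : pzRingType) (M : lmodType R) (F : set (set M)) :
  F !=set0 -> total_on F subset -> (forall A, F A -> is_submod A) ->
  is_submod (\bigcup_(X in F) X).
Proof.
move=> [A0 FA0] Ftot Fsub; split; first by exists A0 => //; case: (Fsub _ FA0).
move=> a x y [A FA Ax] [B FB By].
have [AB|BA] := Ftot _ _ FA FB.
- by exists B => //; have [_] := Fsub _ FB; apply=> //; exact: AB.
- by exists A => //; have [_] := Fsub _ FA; apply=> //; exact: BA.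
Qed.

Variable R : pzRingType.

Lemma is_submodZ (M : lmodType R) (S : set M) a x : is_submod S -> S x -> S (a *: x).
Proof. by move=> [S0 SD] Sx; rewrite -[_ *: _]addr0; exact: SD. Qed.

Lemma is_submodD (M : lmodType R) (S : set M) x y :
  is_submod S -> S x -> S y -> S (x + y).
Proof. by move=> [S0 SD] Sx Sy; rewrite -[x]scale1r; exact: SD. Qed.

Lemma is_submodB (M : lmodType R) (S : set M) x y :
  is_submod S -> S x -> S y -> S (x - y).
Proof.
by move=> subS Sx Sy; rewrite -scaleN1r; apply: is_submodD => //; exact: is_submodZ.
Qed.

(** S is essential in E, expressed on elements: every nonzero element of E has a
nonzero multiple in S. *)
Definition essential_in (M : lmodType R) (S E : set M) :=
  forall x, E x -> x <> 0 -> exists r : R, S (r *: x) /\ r *: x <> 0.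

(** Given submodules S and S' of an injective module I that meet in 0, I is a
direct sum of an essential extension E of S and a submodule T containing S'.
E is a maximal essential extension of S in I, and T is maximal among the
submodules containing S' and meeting E in 0. Then E is essential in I / T, so
the inclusion of E in I extends to an injection of I / T in I, whose image is
an essential extension of S and therefore equals E. *)
Lemma essential_decomposition (I : lmodType R) (S S' : set I) :
  injective_module I -> is_submod S -> is_submod S' ->
  (forall x, S x -> S' x -> x = 0) ->
  exists E T : set I,
    [/\ is_submod E /\ is_submod T, S `<=` E /\ S' `<=` T, essential_in S E,
        forall x, E x -> T x -> x = 0 &
        forall y, exists e t, [/\ E e, T t & y = e + t]].
Proof.
move=> injI subS subS' SS'.
have [||E [[subE essE] SE Emax]] :=
    @zorn_above I [set A | is_submod A /\ essential_in S A] S.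
- by split=> // x Sx x0; exists 1; rewrite scale1r.
- move=> F FP F0 Ftot; split.
    by apply: is_submod_chain => // A /FP[].
  by move=> x [A /FP[_ essA] Ax]; exact: essA.
have ES' x : E x -> S' x -> x = 0.
  move=> Ex S'x; apply: contrapT => x0.
  have [r [Srx]] := essE x Ex x0; apply; apply: SS' => //.
  exact: is_submodZ.
have [||T [[subT ET] S'T Tmax]] :=
    @zorn_above I [set A | is_submod A /\ forall x, E x -> A x -> x = 0] S'.
- by [].
- move=> F FP F0 Ftot; split.
    by apply: is_submod_chain => // A /FP[].
  by move=> x Ex [A /FP[_ EA] Ax]; exact: EA.
(* By maximality of T, a submodule strictly larger than T meets E. *)
have Tess y : ~ T y -> exists r t, [/\ T t, E (t + r *: y) & t + r *: y <> 0].
  move=> Ty; apply: contrapT => no; apply: Ty.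
  pose T' : set I := [set z | exists t r, T t /\ z = t + r *: y].
  apply: (Tmax T'); first split.
  - split; first by exists 0, 0; rewrite scale0r addr0; case: subT.
    move=> a _ _ [t [r [Tt ->]]] [t' [r' [Tt' ->]]].
    exists (a *: t + t'), (a * r + r'); split; first by case: subT => _; exact.
    by rewrite scalerDr scalerDl scalerA addrACA.
  - move=> x Ex [t [r [Tt xE]]]; rewrite xE in Ex *.
    by apply: contrapT => x0; apply: no; exists r, t.
  - by move=> t Tt; exists t, 0; rewrite scale0r addr0.
  - by exists 0, 1; rewrite scale1r add0r; case: subT.
have [Q [p [ps pE]]] := quotient_exists subT.
have [KE [i [ii iE]]] := submodule_exists subE.
have [h hE] : exists h : {linear Q -> I}, forall k, h (p (i k)) = i k.
  apply: (injI _ _ (p \o i) i); apply/linear_injP => k /pE Tik.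
  apply: ii; rewrite linear0; apply: ET Tik; apply/iE; by exists k.
have pess q : q <> 0 -> exists r k, r *: q = p (i k) /\ i k <> 0.
  move=> q0; have [y yE] := ps q.
  have [Ty|r [t [Tt Ez z0]]] := Tess y; first by apply: q0; rewrite -yE; apply/pE.
  have [k kE] := (iE _).1 Ez; exists r, k; rewrite kE; split=> //.
  by rewrite linearD linearZ /= yE (iffRL (pE t) Tt) add0r.
have hQE q : E (h q).
  apply: (Emax [set z | exists q, h q = z]); last by exists q.
    split.
      split=> [|a _ _ [q1 <-] [q2 <-]]; first by exists 0; rewrite linear0.
      by exists (a *: q1 + q2); rewrite linearP.
    move=> _ [q1 <-] hq0.
    have [q10|r [k [rE k0]]] := pess q1; first by apply: hq0; rewrite q10 linear0.
    have [|r' [Sr r'0]] := essE (i k) _ k0; first by apply/iE; exists k.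
    by exists (r' * r); rewrite -scalerA -linearZ /= rE hE.
  by move=> x /iE[k <-]; exists (p (i k)).
exists E, T; split=> // y.
exists (h (p y)), (y - h (p y)); split=> //; last by rewrite addrC subrK.
apply/pE; rewrite linearB; have [k kE] := (iE _).1 (hQE (p y)).
have hinj q : h q = 0 -> q = 0.
  move=> hq; apply: contrapT => /pess[r [k' [rE]]]; apply.
  by rewrite -hE -rE linearZ /= hq scaler0.
apply/hinj; rewrite linearB; apply/eqP; rewrite subr_eq0 -kE hE kE.
exact: eqxx.
Qed.

(** Baer's criterion. The linear map on the left ideal J is given as a function on
R whose values outside J are irrelevant; that it extends to R means that it is
the multiplication by an element e. *)
Lemma baer_criterion (E : lmodType R) :
  (forall (J : set (R^o : lmodType R)) (phi : R^o -> E), is_submod J ->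
    (forall a x y, J x -> J y -> phi (a *: x + y) = a *: phi x + phi y) ->
    exists e, forall x : R^o, J x -> phi x = (x : R) *: e) ->
  injective_module E.
Proof.
move=> baerE A B i g ii.
(* Partial extensions of g along i are represented by their graphs. *)
pose func (G : set (B * E)%type) := forall e, G (0, e) -> e = 0.
have [||G [[subG funG] G0 Gmax]] := @zorn_above (B * E)%type
    [set G | is_submod G /\ func G] [set z | exists a, z = (i a, g a)].
- split; first split.
  + by exists 0; rewrite !linear0.
  + move=> a _ _ [x ->] [y ->]; exists (a *: x + y).
    by rewrite !linearP.
  + move=> e [a [ia0 ->]]; have -> : a = 0 by apply: ii; rewrite linear0 -ia0.
    exact: linear0.
- move=> F FP F0 Ftot; split.
    by apply: is_submod_chain => // X /FP[].
  by move=> e [X /FP[_ funX] Xe]; exact: funX.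
have Geq b e e' : G (b, e) -> G (b, e') -> e = e'.
  move=> Ge Ge'; apply/eqP; rewrite -subr_eq0; apply/eqP/funG.
  have := is_submodB subG Ge Ge'.
  have -> : (b, e) - (b, e') = (b - b, e - e') by [].
  by rewrite subrr.
have GP a b e b' e' : G (b, e) -> G (b', e') -> G (a *: b + b', a *: e + e').
  by move=> Gb Gb'; case: subG => _ /(_ a _ _ Gb Gb').
have G00 : G (0, 0) by case: subG.
have Gtot b : exists e, G (b, e).
  pose J : set R^o := [set r : R | exists e, G (r *: b, e)].
  have phi_ex (r : R^o) : exists e, J r -> G ((r : R) *: b, e).
    have [[e Ge]|nJ] := pselect (J r); last by exists 0.
    by exists e.
  have [phi phiE] := choice phi_ex.
  have subJ : is_submod J.
    split=> [|a x y [e Ge] [e' Ge']]; first by exists 0; rewrite scale0r.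
    exists (a *: e + e'); rewrite scalerDl -scalerA; exact: GP.
  have [|e0 e0E] := baerE J phi subJ.
    move=> a x y Jx Jy; apply: Geq; first by apply: phiE; case: subJ => _; exact.
    by rewrite scalerDl -scalerA; apply: GP; exact: phiE.
  pose G' : set (B * E)%type :=
    [set z | exists x y r, G (x, y) /\ z = (x + r *: b, y + r *: e0)].
  have : G' (b, e0).
    by exists 0, 0, 1; rewrite !scale1r !add0r.
  move=> G'b; exists e0; apply: (Gmax G') G'b.
    split; first split.
    + by exists 0, 0, 0; rewrite !scale0r !addr0.
    + move=> a _ _ [x [y [r [Gx ->]]]] [x' [y' [r' [Gx' ->]]]].
      exists (a *: x + x'), (a *: y + y'), (a * r + r'); split; first exact: GP.
      by congr pair; rewrite /= scalerDr scalerDl scalerA addrACA.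
    + move=> e [x [y [r [Gx [/esym/eqP]]]]].
      rewrite addr_eq0 => /eqP xE ->.
      rewrite xE -scaleNr in Gx.
      have Jr : J (- r) by exists y.
      rewrite (Geq _ _ _ Gx (phiE _ Jr)) e0E //.
      by rewrite scaleNr addNr.
  by move=> [x y] Gx; exists x, y, 0; rewrite !scale0r !addr0.
have [|||h hE] := @linear_of_rel R B E (fun b e => G (b, e)) => //.
- by move=> a x x' y y'; exact: GP.
by exists h => x; apply: Geq (hE _) _; apply: G0; exists x.
Qed.

(** The Noetherian hypothesis is used to show that a linear map phi from a left
ideal J to the direct sum takes its values in finitely many summands s; its
components, which extend to R one at a time, then give finitely many nonzero
coordinates. *)
Lemma injective_dsum (X : eqType) (E : lmodType R) :
  left_noetherian R -> injective_module E -> injective_module (dsum X E).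
Proof.
move=> noethR injE; apply: baer_criterion => J phi subJ phiP.
have coordP x : exists e, forall r : R^o, J r -> dsum_coord x (phi r) = (r : R) *: e.
  have [K [i [ii iE]]] := submodule_exists subJ.
  have [|g gE] := @linear_of_fun R K E (fun k => dsum_coord x (phi (i k))).
    move=> a k l; rewrite linearP phiP ?linearP //; apply/iE; [by exists k|by exists l].
  have [h hE] := injE _ _ i g ii; exists (h (1 : R^o)) => r /iE[k <-].
  rewrite -gE -hE -linearZ; congr (h _); exact/esym/mulr1.
have phi0 : phi 0 = 0.
  have [J0 _] := subJ; have := phiP (-1) 0 0 J0 J0.
  by rewrite scaler0 addr0 scaleN1r addNr.
(* The part of J that phi maps to the summands indexed by s. *)
pose In (s : seq X) : {pred R^o} :=
  fun r => `[< J r /\ forall x, x \notin s -> dsum_coord x (phi r) = 0 >].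
have In_closed s : GRing.submod_closed (In s).
  split=> [|a r r' /asboolP[Jr rs] /asboolP[Jr' rs']]; apply/asboolP; split.
  - by case: subJ.
  - by move=> x _; rewrite phi0 linear0.
  - by case: subJ => _; exact.
  - by move=> x xs; rewrite phiP // linearP /= rs // rs' // scaler0 addr0.
have [s sE] : exists s : seq X, forall r, J r ->
    forall x, x \notin s -> dsum_coord x (phi r) = 0.
  apply: contrapT => no.
  have step (s : seq X) : exists t : seq X, {subset s <= t} /\
      exists2 r, r \in In t & r \notin In s.
    apply: contrapT => nostep; apply: no; exists s => r Jr x xs.
    have [t [_ rt]] := dsum_supp (phi r).
    apply: contrapT => rx; apply: nostep; exists (s ++ t); split.
      by move=> y ys; rewrite mem_cat ys.
    exists r.
      apply/asboolP; split=> // y; rewrite mem_cat negb_or => /andP[_]; exact: rt.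
    by apply/asboolPn => -[_ /(_ x xs)].
  have [nxt nxtE] := choice step.
  have [||N NE] := noethR (fun n => In (iter n nxt [::])).
  - by move=> n; exact: In_closed.
  - move=> n r /asboolP[Jr rn]; apply/asboolP; split=> // x xn; apply: rn.
    by apply: contra xn => xn; have [sub _] := nxtE (iter n nxt [::]); exact: sub.
  have [_ [r rin rout]] := nxtE (iter N nxt [::]).
  by move: rout; rewrite -(NE N.+1 (leqnSn _) r) /= rin.
have [e eE] := choice coordP.
have [|u uE] := @dsum_build R X E (fun x => if x \in s then e x else 0) s.
  by move=> x /negPf->.
exists u => r Jr; apply: dsum_ext => x; rewrite linearZ /= uE.
by case: ifPn => [_|xs]; [rewrite eE|rewrite sE ?scaler0].
Qed.

Lemma injective_prod (E E' : lmodType R) :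
  injective_module E -> injective_module E' -> injective_module (E * E')%type.
Proof.
move=> injE injE' A B i g ii.
have [h hE] := injE _ _ i (fst \o g) ii; have [h' hE'] := injE' _ _ i (snd \o g) ii.
have [k kE] := pair_linear h h'; exists k => x.
by rewrite kE hE hE' /=; case: (g x).
Qed.

Lemma injective_retract (E I : lmodType R) (i : {linear E -> I}) (r : {linear I -> E}) :
  cancel i r -> injective_module I -> injective_module E.
Proof.
move=> iK injI A B j g ji; have [h hE] := injI _ _ j (i \o g) ji.
by exists (r \o h) => x; rewrite /= hE /= iK.
Qed.

End Injectivity.

(** * Injective coresolutions of bounded flat dimension *)

Section AuslanderCondition.
Local Open Scope classical_set_scope.
Variable R : pzRingType.

Lemma flat_dim_leS n (M : lmodType R) : flat_dim_le n M -> flat_dim_le n.+1 M.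
Proof.
move=> /(resdim_leP (flat_resolving R)) Mn; apply/(resdim_leP (flat_resolving R)).
exact: (resdim_leS (flat_resolving R) Mn).
Qed.

Lemma flat_dim_le_prod n (M N : lmodType R) :
  flat_dim_le n M -> flat_dim_le n N -> flat_dim_le n (M * N)%type.
Proof.
move=> /(resdim_leP (flat_resolving R)) Mn /(resdim_leP (flat_resolving R)) Nn.
by apply/(resdim_leP (flat_resolving R)); apply: resdim_prod => //; exact: flat_resolving.
Qed.

Lemma flat_dim_le_summand n (M N N' : lmodType R) (phi : {linear M -> (N * N')%type}) :
  bijective phi -> flat_dim_le n M -> flat_dim_le n N.
Proof.
move=> bij_phi /(resdim_leP (flat_resolving R)) Mn.
apply/(resdim_leP (flat_resolving R)).
exact: (resdim_summand (flat_resolving R) bij_phi Mn).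
Qed.

(** M embeds in an injective module of flat dimension at most n with a cokernel in
[Q n.+1]. *)
Definition ac_step (Q : nat -> lmodType R -> Prop) n (M : lmodType R) : Prop :=
  exists (E M' : lmodType R) (i : {linear M -> E}) (p : {linear E -> M'}),
    [/\ short_exact i p, injective_module E, flat_dim_le n E & Q n.+1 M'].

(** M has an injective coresolution, not necessarily minimal, whose i-th term has
flat dimension at most n + i. It is defined as the largest predicate stable
under [ac_step], so that it is proved by exhibiting an invariant Q. *)
Definition ac_from (n : nat) (M : lmodType R) : Prop :=
  exists2 Q : nat -> lmodType R -> Prop,
    (forall k N, Q k N -> ac_step Q k N) & Q n M.

Lemma ac_from_step n M : ac_from n M -> ac_step ac_from n M.
Proof.
move=> [Q QS QM]; have [E [M' [i [p [ip injE fdE QM']]]]] := QS _ _ QM.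
by exists E, M', i, p; split=> //; exists Q.
Qed.

Lemma ac_from_extension n (A B C : lmodType R) (f : {linear A -> B})
    (g : {linear B -> C}) :
  short_exact f g -> ac_from n A -> ac_from n C -> ac_from n B.
Proof.
move=> fg An Cn.
exists (fun (k : nat) (N : lmodType R) =>
  exists (A C : lmodType R) (f : {linear A -> N}) (g : {linear N -> C}),
  [/\ short_exact f g, ac_from k A & ac_from k C]); last by exists A, C, f, g.
move=> {}n {f g A B C fg An Cn} B [A [C [f [g [fg /ac_from_step An /ac_from_step Cn]]]]].
have [EA [A' [iA [pA [sA injA fdA A'n]]]]] := An.
have [EC [C' [iC [pC [sC injC fdC C'n]]]]] := Cn.
have [B' [iB [pB [f' [g' [sB s']]]]]] := injective_horseshoe fg sA sC injA.
exists (EA * EC)%type, B', iB, pB; split=> //.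
- exact: injective_prod.
- exact: flat_dim_le_prod.
- by exists A', C', f', g'.
Qed.

Lemma ac_fromS n M : ac_from n M -> ac_from n.+1 M.
Proof.
move=> Mn; exists (fun (k : nat) (N : lmodType R) => if k is m.+1 then ac_from m N else False) => //.
case=> // {Mn M}n M /ac_from_step[E [M' [i [p [ip injE fdE M'n]]]]].
by exists E, M', i, p; split=> //; exact: flat_dim_leS.
Qed.

Lemma ac_from_kernel n (A B C : lmodType R) (f : {linear A -> B})
    (g : {linear B -> C}) :
  short_exact f g -> ac_from n B -> ac_from n C -> ac_from n A.
Proof.
move=> fg /ac_from_step[E [B' [i [p [ip injE fdE B'n]]]]] Cn.
have [A' [j [q [f' [g' [jq s']]]]]] := cosyzygy_subobject fg ip.
(* A' is an extension of B' by C. *)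
have A'n : ac_from n.+1 A' by exact: ac_from_extension s' (ac_fromS Cn) B'n.
exists (fun (k : nat) (N : lmodType R) => ac_from k N \/ k = n /\ N = A); last by right.
move=> k N [/ac_from_step[E1 [N' [i1 [p1 [? ? ? N'k]]]]]|[-> ->]].
  by exists E1, N', i1, p1; split=> //; left.
by exists E, A', j, q; split=> //; left.
Qed.

Lemma ac_from_dsum (X : eqType) n M :
  left_noetherian R -> ac_from n M -> ac_from n (dsum X M).
Proof.
move=> noethR Mn.
exists (fun (k : nat) (N : lmodType R) => exists2 M, N = dsum X M & ac_from k M); last by exists M.
move=> {Mn M}n _ [M ->] /ac_from_step[E [M' [i [p [ip injE fdE M'n]]]]].
exists (dsum X E), (dsum X M'), (dsum_map X i), (dsum_map X p); split.
- exact: dsum_short_exact.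
- exact: injective_dsum.
- by apply: dsum_resolution fdE; exact: flat_dsum.
- by exists M'.
Qed.

(** N is a direct summand of a module satisfying [ac_from n]. *)
Definition ac_summand n (N : lmodType R) : Prop :=
  exists (M N' : lmodType R) (phi : {linear M -> (N * N')%type}),
    bijective phi /\ ac_from n M.

(** The invariant [ac_summand] can be continued with essential embeddings; this
yields both closure under direct summands and minimal coresolutions. *)
Lemma ac_summand_step n N : ac_summand n N ->
  exists (E N1 : lmodType R) (i : {linear N -> E}) (p : {linear E -> N1}),
    [/\ short_exact i p, injective_module E, flat_dim_le n E, essential_image i
      & ac_summand n.+1 N1].
Proof.
move=> [M [N' [phi [bij_phi Mn]]]].
have [phi' phiK phi'K] := bij_phi.
have [|y|psi [psiK psi'K]] := @linear_inverse R _ _ phi; first exact: bij_inj.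
  by exists (phi' y); rewrite phi'K.
have [I [M1 [j [q [jq injI fdI M1n]]]]] := ac_from_step Mn.
have [ji jqE qs] := jq.
have [a aE] := inl_linear N N'; have [b bE] := inr_linear N N'.
have jpsi_inj : injective (j \o psi).
  by move=> x y /= /ji /(can_inj psi'K).
have jpsiE x : j (psi x) = j (psi (a x.1)) + j (psi (b x.2)).
  rewrite -!linearD aE bE; congr (j (psi _)); case: x => x y.
  by congr pair; rewrite /= ?addr0 ?add0r.
have subim (L : lmodType R) (f : {linear L -> I}) :
    is_submod [set y | exists x, f x = y].
  split=> [|r _ _ [x <-] [y <-]]; first by exists 0; rewrite linear0.
  by exists (r *: x + y); rewrite linearP.
have [|E [T [[subE subT] [SE S'T] essE ET spanET]]] :=
    @essential_decomposition R I _ _ injI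
      (subim N (j \o psi \o a)) (subim N' (j \o psi \o b)).
  move=> _ [x <-] [y /= /ji /(can_inj psi'K) ba].
  have [<- _] : (0, y) = (x, 0) by rewrite -aE -bE.
  by rewrite /= !linear0.
have [KE [iE [iEi iEE]]] := submodule_exists subE.
have [KT [iT [iTi iTE]]] := submodule_exists subT.
have zeroET k l : iE k + iT l = 0 -> k = 0 /\ l = 0.
  move=> /eqP; rewrite addr_eq0 => /eqP kl.
  have k0 : iE k = 0.
    apply: ET; first by apply/iEE; exists k.
    by rewrite kl -linearN; apply/iTE; exists (- l).
  split; first by apply: iEi; rewrite k0 linear0.
  by apply: iTi; apply/eqP; rewrite linear0 -oppr_eq0 -kl k0.
have [|[k l] /= /esym/zeroET[-> ->]|r y y' z z' -> ->|d dE] := @linear_of_rel R I (KE * KT)%type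
  (fun y z => y = iE z.1 + iT z.2) => //.
- move=> y; have [_ [_ [/iEE[k <-] /iTE[l <-] ->]]] := spanET y.
  by exists (k, l).
- by rewrite !linearP /= scalerDr addrACA.
have dK k l : d (iE k + iT l) = (k, l).
  have := dE (iE k + iT l); case: (d _) => k' l' /= /eqP.
  rewrite -subr_eq0 opprD addrACA -!linearB => /eqP/zeroET[/eqP + /eqP].
  by rewrite !subr_eq0 => /eqP-> /eqP->.
(* d is the decomposition I = E (+) T. *)
have bij_d : bijective d.
  exists (fun z => iE z.1 + iT z.2) => [y|[k l]]; first by rewrite -dE.
  by rewrite dK.
have [x|u uE] := @factor_inj _ _ _ _ iE (j \o psi \o a) iEi.
  by apply/iEE; apply: SE; exists x.
have [x|v vE] := @factor_inj _ _ _ _ iT (j \o psi \o b) iTi.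
  by apply/iTE; apply: S'T; exists x.
rewrite /= in uE vE.
have djpsi x : d (j (psi x)) = (u x.1, v x.2).
  by rewrite jpsiE -uE -vE dK.
have [N1 [p [ps up]]] := cokernel_exists u.
have [N1' [p' [ps' vp']]] := cokernel_exists v.
have [w wE] := prod_linear p p'.
have [_ /jqE[m <-]|phi1 phi1E] := @factor_surj _ _ _ _ q (w \o d) qs.
  rewrite -[m]psiK /= djpsi wE /=.
  by rewrite (exact_comp0 _ up) (exact_comp0 _ vp').
rewrite /= in phi1E.
exists KE, N1, u, p; split.
- split=> //; apply/linear_injP => x ux.
  have : (j \o psi) (a x) = (j \o psi) 0 by rewrite /= -uE ux !linear0.
  by move=> /jpsi_inj; rewrite aE => -[].
- apply: (@injective_retract R KE I iE (fst \o d)) => // k.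
  by rewrite /= -[iE k]addr0 -[0](linear0 iT) dK.
- exact: flat_dim_le_summand bij_d fdI.
- move=> S [S0 SD] Su y Sy; apply: contrapT => y0.
  (* A nonzero y in S would have a nonzero multiple in the image of N. *)
  have [||r [[x /= xE] ry0]] := essE (iE y); first by apply/iEE; exists y.
    by rewrite -(linear0 iE) => /iEi.
  apply: ry0; rewrite -xE -uE.
  have uxE : u x = r *: y by apply: iEi; rewrite uE xE linearZ.
  by rewrite Su ?linear0 // uxE -[_ *: _]addr0 SD.
- exists M1, N1', phi1; split=> //.
  have [|y|phi1' [phi1K phi1'K]] := @linear_inverse R _ _ phi1.
  + apply/linear_injP => z; have [y <-] := qs z.
    rewrite phi1E wE => -[/up[x xE] /vp'[x' xE']].
    apply/jqE; exists (psi (x, x')); apply: (bij_inj bij_d).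
    by rewrite djpsi /= xE xE'; case: (d y).
  + have [k kE] := ps y.1; have [l lE] := ps' y.2.
    exists (q (iE k + iT l)); rewrite phi1E dK wE /= kE lE.
    by case: (y).
  + by exists phi1'.
Qed.

Lemma ac_summand_from n N : ac_summand n N -> ac_from n N.
Proof.
move=> Nn; exists ac_summand => // k M /ac_summand_step.
by move=> [E [M' [i [p [ip injE fdE _ M'k]]]]]; exists E, M', i, p.
Qed.

Lemma ac_from_summand n N : ac_from n N -> ac_summand n N.
Proof.
move=> Nn; have [Z Z0] := zero_module_exists R; have [h hE] := inl_linear N Z.
exists N, Z, h; split=> //; exists fst => [x|[x z]]; rewrite hE //=.
by rewrite (Z0 z).
Qed.

Lemma auslander_ac_from M : auslander_condition M -> ac_from 0 M.
Proof.
move=> [E [eta [d [[injE [etai etad] dd _ _] fdE]]]].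
exists (fun (n : nat) (N : lmodType R) =>
  exists (E : nat -> lmodType R) (eta : {linear N -> E 0%N})
    (d : forall i, {linear E i -> E i.+1}),
  [/\ forall i, injective_module (E i), injective eta, exact_at eta (d 0%N),
      forall i, exact_at (d i) (d i.+1) & forall i, flat_dim_le (n + i) (E i)]);
  last by exists E, eta, d.
move=> n N {M E eta d injE etai etad dd fdE}.
move=> [E [eta [d [injE etai etad dd fdE]]]].
have [K [i [ii iE]]] := kernel_exists (d 1%N).
have [x|p pE] := @factor_inj _ _ _ _ i (d 0%N) ii.
  by apply/iE/dd; exists x.
exists (E 0%N), K, eta, p; split=> //.
- split=> //.
  + move=> y; rewrite -etad -pE; split=> [->|py]; first exact: linear0.
    by apply: ii; rewrite py linear0.
  + move=> k; have /dd[y yE] : d 1%N (i k) = 0 by exact: exact_comp0.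
    by exists y; apply: ii; rewrite pE.
- by have := fdE 0%N; rewrite addn0.
- exists (fun m => E m.+1), i, (fun m => d m.+1); split=> // m.
  by rewrite addSnnS.
Qed.

(** The minimal coresolution is obtained from [ac_summand_step] by dependent choice,
splicing the short exact sequences at their common terms. *)
Lemma ac_from_auslander M : ac_from 0 M -> auslander_condition M.
Proof.
move=> /ac_from_summand M0.
pose next n (N : {N : lmodType R | ac_summand n N}) :=
  {N1 : {N1 : lmodType R | ac_summand n.+1 N1} &
   {E : lmodType R & {i : {linear sval N -> E} & {p : {linear E -> sval N1} |
     [/\ short_exact i p, injective_module E, flat_dim_le n E & essential_image i]}}}}.
have step n N : next n N.
  case: N => N Nn.
  have /cid[E /cid[N1 /cid[i /cid[p [ip injE fdE essi N1n]]]]] := ac_summand_step Nn.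
  by exists (exist _ N1 N1n), E, i, p.
pose fix st n : {N : lmodType R | ac_summand n N} :=
  if n is m.+1 then projT1 (step m (st m)) else exist _ M M0.
pose E n : lmodType R := projT1 (projT2 (step n (st n))).
pose i n : {linear sval (st n) -> E n} := projT1 (projT2 (projT2 (step n (st n)))).
pose p n : {linear E n -> sval (st n.+1)} := sval (projT2 (projT2 (projT2 (step n (st n))))).
have ipP n : [/\ short_exact (i n) (p n), injective_module (E n),
    flat_dim_le n (E n) & essential_image (i n)].
  exact: svalP (projT2 (projT2 (projT2 (step n (st n))))).
have comp_exact (L : lmodType R) n (f : {linear L -> E n}) :
    exact_at f (p n) -> exact_at f (i n.+1 \o p n).
  move=> fp y; rewrite -fp /=; split=> [|->]; last by rewrite linear0.
  by have [[/linear_injP in_ _ _] _ _ _] := ipP n.+1; exact: in_.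
exists E, (i 0%N), (fun n => i n.+1 \o p n); split; last by move=> n; case: (ipP n).
split.
- by move=> n; case: (ipP n).
- by have [[i0 ip _] _ _ _] := ipP 0%N; split=> //; exact: comp_exact.
- move=> n; have [[_ ip _] _ _ _] := ipP n.+1.
  apply: comp_exact => y; rewrite ip; have [[_ _ pns] _ _ _] := ipP n.
  split=> [[x <-]|[z <-]]; last by exists (p n z).
  by have [z <-] := pns x; exists z.
- by case: (ipP 0%N).
- move=> n S subS Sf y Sy; have [_ _ _ ess] := ipP n.+1.
  apply: ess Sy => // x Sx; have [[_ _ pns] _ _ _] := ipP n.
  by have [z zE] := pns x; rewrite -zE; apply: Sf; rewrite /= zE.
Qed.

Lemma auslander_resolving :
  left_noetherian R -> auslander_condition (R^o : lmodType R) ->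
  resolving (@auslander_condition R).
Proof.
move=> noethR ACR.
have summ (M N N' : lmodType R) (phi : {linear M -> (N * N')%type}) :
    bijective phi -> ac_from 0 M -> ac_from 0 N.
  by move=> bij_phi M0; apply: ac_summand_from; exists M, N', phi.
split.
- move=> P projP; apply: ac_from_auslander.
  have [p ps] := free_cover P; have [h hE] := projP _ _ p idfun ps.
  (* The section h of the free cover p makes P a summand, with complement K. *)
  have [K [i [ii ip]]] := kernel_exists p.
  have [x|r rE] := @factor_inj _ _ _ _ i (idfun \- (h \o p)) ii.
    by apply/ip; rewrite /= linearB hE subrr.
  have [phi phiE] := pair_linear p r.
  apply: (summ _ P K phi); last exact/ac_from_dsum/auslander_ac_from.
  exists (fun z => h z.1 + i z.2) => [x|[y k]]; rewrite phiE /=.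
    by rewrite rE /= addrC subrK.
  have py : p (h y + i k) = y by rewrite linearD hE (exact_comp0 _ ip) addr0.
  by congr pair => //; apply: ii; rewrite rE /= py addrC addKr.
- move=> M N N' phi bij_phi /auslander_ac_from M0.
  by apply: ac_from_auslander; exact: summ bij_phi M0.
- move=> A B C f g fg /auslander_ac_from A0 /auslander_ac_from C0.
  by apply: ac_from_auslander; exact: ac_from_extension fg A0 C0.
- move=> A B C f g fg /auslander_ac_from B0 /auslander_ac_from C0.
  by apply: ac_from_auslander; exact: ac_from_kernel fg B0 C0.
Qed.

End AuslanderCondition.

Theorem corollary3p6 (R : pzRingType) (noethR : left_noetherian R)
    (ACR : auslander_condition (R^o : lmodType R)) :
  resolving (@AC_fin R).
Proof. exact: finite_resdim_resolving (auslander_resolving noethR ACR). Qed.
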